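(* Let $N\ge2$. Suppose $m_0$ is a Lipschitz function on $\mathbb{T}$ with finitely many zeros and $R_{m_0}1=1$, and let $C_i=\{z^i_0,\dots,z^i_{p_i-1}\}$, $i\in\{1,\dots,n\}$, be the $m_0$-cycles (assume there is at least one). Let $W=|m_0|^2/N$ and let $P_x$, $m$ be the associated measures. Then for all $x\in[0,1)$ the measure $P_x$ is atomic, concentrated on $$\{\omega(x,i,a,k)\mid a\in\mathbb{Z},\ k\in\{0,\dots,p_i-1\},\ i\in\{1,\dots,n\}\},$$ and $$P_x(\{\omega(x,i,a,k)\})=|\hat\varphi^i_k(x+a-\theta^i_k)|^2\qquad(a\in\mathbb{Z},\ k\in\{0,\dots,p_i-1\},\ i\in\{1,\dots,n\}).$$ The measure $m$ is supported on (i.e. its complement is $m$-null) $\bigcup_{i=1}^n\bigcup_{k=0}^{p_i-1}S^{-k}(z_{C_i})\,\hat i(\mathbb{R})$.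
   Context: $\mathbb{T}$ is the unit circle; functions $f$ on $\mathbb{T}$ are identified with $1$-periodic functions on $\mathbb{R}$ by $f(x):=f(e^{-2\pi i x})$. $R_{m_0}f(z)=\frac1N\sum_{w^N=z}|m_0(w)|^2f(w)$. A cycle is a periodic orbit of $z\mapsto z^N$ on $\mathbb{T}$: $C=\{z_0,\dots,z_{p-1}\}$, distinct points with $z_j^N=z_{(j+1)\bmod p}$. It is an $m_0$-cycle if $|m_0(z_j)|=\sqrt N$ for all $j$. For the $m_0$-cycle $C_i$ and $k\in\mathbb{Z}$, let $\theta^i_k\in\mathbb{R}$ (depending only on $k\bmod p_i$) satisfy $e^{-2\pi i\theta^i_k}=z^i_{k\bmod p_i}$, let $\alpha^i_k=m_0(z^i_{k\bmod p_i})/\sqrt N\in\mathbb{T}$, and define $$\hat\varphi^i_k(x)=\prod_{l=1}^\infty\frac{\overline{\alpha^i_{k-l}}\;m_0\left(\frac{x}{N^l}+\theta^i_{k-l}\right)}{\sqrt N}\qquad(x\in\mathbb{R}).$$ Solenoid: $\mathcal{S}_N=\{(z_l)_{l\in\mathbb{Z}}\mid z_{l+1}^N=z_l,\ |z_l|=1\}$ (a group under coordinatewise multiplication; elements are determined by $(z_l)_{l\ge0}$), $S(z_l)_l=(z_{l-1})_l$, $\hat i(x)=(e^{-2\pi i N^{-l}x})_{l\in\mathbb{Z}}$ for $x\in\mathbb{R}$, and for a cycle $C$ of length $p$, $z_C=(z_{(-l)\bmod p})_{l\in\mathbb{Z}}\in\mathcal{S}_N$. Let $\tau_k(x)=\frac{x+k}{N}$,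 $k\in\{0,\dots,N-1\}$, and $\Omega=\{0,\dots,N-1\}^{\{1,2,\dots\}}$. Since $\sum_kW(\tau_kx)=1$, for each $x\in[0,1)$ there is a unique Borel probability measure $P_x$ on $\Omega$ such that for $f$ depending only on $\omega_1,\dots,\omega_r$, $\int_\Omega f\,dP_x=\sum_{\omega_1,\dots,\omega_r}f(\omega_1,\dots,\omega_r)W(\tau_{\omega_1}x)\cdots W(\tau_{\omega_r}\cdots\tau_{\omega_1}x)$. The map $\Phi:[0,1)\times\Omega\to\mathcal{S}_N$, $\Phi(x,\omega)=(e^{-2\pi i x},e^{-2\pi i\tau_{\omega_1}x},e^{-2\pi i\tau_{\omega_2}\tau_{\omega_1}x},\dots)$ (coordinates $z_0,z_1,\dots$) is a measurable bijection, and $m$ is the Borel probability measure on $\mathcal{S}_N$ with $\int f\,dm=\int_0^1\int_\Omega f(\Phi(x,\omega))\,dP_x(\omega)\,dx$ for $f\in C(\mathcal{S}_N)$. For $x\in[0,1)$, $a\in\mathbb{Z}$, $k\in\{0,\dots,p_i-1\}$, the point $z(x,i,a,k)=\left(e^{-2\pi i\left(\frac{x+a-\theta^i_k}{N^l}+\theta^i_{k-l}\right)}\right)_{l\in\mathbb{Z}}$ lies in $\mathcal{S}_N$ and has zeroth coordinate $e^{-2\pi i x}$; $\omega(x,i,a,k)\in\Omega$ is defined by $\Phi(x,\omega(x,i,a,k))=z(x,i,a,k)$. (In exponents $e^{-2\pi i\,\cdot}$, $i$ is the imaginary unit; elsewhere $i$ indexes cycles.) *)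

(* Defs.v *)
From HB Require Import structures.
From mathcomp Require Import all_boot all_order all_algebra.
From mathcomp Require Import complex.
From mathcomp Require Import all_classical all_reals all_analysis.
Import Order.TTheory GRing.Theory Num.Theory.
Import numFieldNormedType.Exports.

Set Implicit Arguments.
Unset Strict Implicit.
Unset Printing Implicit Defensive.

Local Open Scope classical_set_scope.
Local Open Scope ring_scope.
Local Open Scope complex_scope.

(* R[i] gets its usual (norm) topology from the generic instance R[i]^o. *)
HB.instance Definition _ (R : realType) := NormedModule.copy R[i] R[i]^o.

Section Circle.
Variable R : realType.

Definition circle : set R[i] := [set z | `|z| = 1].

(* e^{-2 pi i x}; a function f on the circle is evaluated at a real x as
   f (ez x). *)
Definition ez (x : R) : R[i] := cos (2 * pi * x) -i* sin (2 * pi * x).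

Lemma ezD x y : ez (x + y) = ez x * ez y.
Proof.
rewrite /ez mulrDr cosD sinD; apply/eqP; rewrite eq_complex /=.
rewrite mulrNN !(mulrN, mulNr) opprD; apply/andP; split; apply/eqP => //.
by rewrite addrC.
Qed.

Lemma ez0 : ez 0 = 1.
Proof. by rewrite /ez mulr0 cos0 sin0 oppr0. Qed.

Lemma ez1 : ez 1 = 1.
Proof. by rewrite /ez mulr1 mulr_natl cos2pi sin2pi oppr0. Qed.

Lemma ezMn x n : ez (x *+ n) = ez x ^+ n.
Proof.
by elim: n => [|n IH]; rewrite ?mulr0n ?ez0 ?expr0 // mulrS ezD IH exprS.
Qed.

Lemma norm_ez x : `|ez x| = 1.
Proof. by rewrite normc_def /= sqrrN cos2Dsin2 sqrtr1. Qed.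

End Circle.
Arguments circle : clear implicits.

Section TransferAndCycles.
Variables (R : realType) (N : nat).

Definition ruelle (m0 f : R[i] -> R[i]) (z : R[i]) : R[i] :=
  N%:R^-1 * \sum_(w \in [set w : R[i] | w ^+ N = z]) `|m0 w| ^+ 2 * f w.

(* A cycle z_0, ..., z_{p-1} is the sequence of its points, with p its size. *)
Definition is_cycle (c : seq R[i]) : Prop :=
  [/\ (0 < size c)%N, uniq c,
      forall j, (j < size c)%N -> circle R c`_j
    & forall j, (j < size c)%N -> c`_j ^+ N = c`_(j.+1 %% size c)].

Definition is_m0_cycle (m0 : R[i] -> R[i]) (c : seq R[i]) : Prop :=
  is_cycle c /\
  forall j, (j < size c)%N -> `|m0 c`_j| = (Num.sqrt (N%:R : R))%:C.

(* The Cs i are the m0-cycles: every m0-cycle has, as a set of points, exactly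
   one index i. *)
Definition enumerates_m0_cycles (m0 : R[i] -> R[i]) (n : nat)
    (Cs : 'I_n -> seq R[i]) : Prop :=
  (forall i, is_m0_cycle m0 (Cs i)) /\
  (forall c, is_m0_cycle m0 c -> exists! i, Cs i =i c).

Definition cycle_pt (c : seq R[i]) (k : int) : R[i] :=
  c`_(`|(k %% (size c)%:Z)%Z|%N).

Definition is_argument (c : seq R[i]) (theta : int -> R) : Prop :=
  forall k, theta k = theta (k %% (size c)%:Z)%Z /\
            ez (theta k) = cycle_pt c k.

Definition alpha (m0 : R[i] -> R[i]) (c : seq R[i]) (k : int) : R[i] :=
  m0 (cycle_pt c k) / (Num.sqrt (N%:R : R))%:C.

Definition phi_hat (m0 : R[i] -> R[i]) (c : seq R[i]) (theta : int -> R)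
    (k : int) (x : R) : R[i] :=
  limn (fun n => \prod_(1 <= l < n.+1)
    ((alpha m0 c (k - l%:Z))^* * m0 (ez (x / N%:R ^+ l + theta (k - l%:Z)))
      / (Num.sqrt (N%:R : R))%:C)).

Definition W (m0 : R[i] -> R[i]) (x : R) : R :=
  (Normc.normc (m0 (ez x))) ^+ 2 / N%:R.

End TransferAndCycles.

Section Solenoid.
Variables (R : realType) (N : nat).

Definition solenoid_set : set {ptws int -> R[i]} :=
  [set z | forall l, `|z l| = 1 /\ z (l + 1) ^+ N = z l].

(* The solenoid, with the topology induced by the product topology. *)
Definition solenoid : Type := set_type solenoid_set.
HB.instance Definition _ := Topological.on solenoid.

Lemma one_solenoid : solenoid_set (fun=> 1).
Proof. by move=> l; rewrite normr1 expr1n. Qed.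

HB.instance Definition _ := isPointed.Build solenoid
  (exist (fun z => z \in solenoid_set) _ (mem_set one_solenoid)).

Definition borel_solenoid : Type :=
  g_sigma_algebraType (@open solenoid).
HB.instance Definition _ := Measurable.on borel_solenoid.

Definition shift (z : int -> R[i]) : int -> R[i] := fun l => z (l - 1).
Definition shift_inv (z : int -> R[i]) : int -> R[i] := fun l => z (l + 1).

Lemma shiftK : cancel shift shift_inv.
Proof. by move=> z; apply/funext => l; rewrite /shift_inv /shift addrK. Qed.

Lemma shift_invK : cancel shift_inv shift.
Proof. by move=> z; apply/funext => l; rewrite /shift_inv /shift subrK. Qed.

Definition i_hat (x : R) : int -> R[i] := fun l => ez (N%:R ^ (- l) * x).

Definition cycle_solenoid (c : seq R[i]) : int -> R[i] :=
  fun l => cycle_pt c (- l).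

(* S^{-k}(z_C) i_hat(R) *)
Definition translated_line (c : seq R[i]) (k : nat) : set solenoid :=
  [set z | exists x : R,
    set_val z = iter k shift_inv (cycle_solenoid c) \* i_hat x].

(* z(x,i,a,k), for the cycle c = C_i *)
Definition solenoid_pt (theta : int -> R) (x : R) (a k : int) : int -> R[i] :=
  fun l => ez ((x + a%:~R - theta k) / N%:R ^ l + theta (k - l)).

End Solenoid.

Section Digits.
Variables (R : realType) (N : nat) (N2 : (1 < N)%N).

(* The digit omega_(j+1) is w j. *)
Definition Omega of (1 < N)%N : Type := nat -> 'I_N.
HB.instance Definition _ := gen_eqMixin (Omega N2).
HB.instance Definition _ := gen_choiceMixin (Omega N2).
HB.instance Definition _ := isPointed.Build (Omega N2)
  (fun=> Ordinal (ltnW N2)).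

Definition cylinders : set (set (Omega N2)) :=
  [set A | exists j (k : 'I_N), A = [set w | w j = k]].

(* The Borel sigma-algebra of the product of the discrete spaces
   {0, ..., N-1}. *)
Definition borel_Omega : Type := g_sigma_algebraType cylinders.
HB.instance Definition _ := Measurable.on borel_Omega.

Definition tau (k : 'I_N) (x : R) : R := (x + (k : nat)%:R) / N%:R.

(* tau_word x [:: w1; ...; wl] is tau_wl (... (tau_w1 x)). *)
Definition tau_word (x : R) (s : seq 'I_N) : R :=
  foldl (fun y k => tau k y) x s.

Definition is_path_measure (m0 : R[i] -> R[i]) (x : R)
    (P : probability borel_Omega R) : Prop :=
  forall (r : nat) (f : r.-tuple 'I_N -> R),
  (\int[P]_w (f [tuple w (j : nat) | j < r])%:E =
   (\sum_(v : r.-tuple 'I_N)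
      f v * \prod_(j < r) W N m0 (tau_word x (take j.+1 v)))%:E)%E.

(* Coordinates of negative index are forced by z_(l+1)^N = z_l. *)
Definition Phi_seq (x : R) (w : Omega N2) : int -> R[i] := fun l =>
  match l with
  | Posz j => ez (tau_word x (mkseq w j))
  | Negz j => ez x ^+ (N ^ j.+1)
  end.

Lemma Phi_seq_solenoid x w : solenoid_set N (Phi_seq x w).
Proof.
have N0 : (N%:R : R) != 0 by rewrite pnatr_eq0 -lt0n ltnW.
have ezt k y : ez (tau k y) ^+ N = ez y.
  have ezn n : ez (n%:R : R) = 1 by rewrite ezMn ez1 expr1n.
  by rewrite -ezMn -mulr_natr /tau divfK// ezD ezn mulr1.
case=> [j|j]; split.
- exact: norm_ez.
- have -> : Posz j + 1 = Posz j.+1 by rewrite -PoszD addn1.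
  by rewrite /Phi_seq mkseqS /tau_word foldl_rcons ezt.
- by rewrite /Phi_seq normrX norm_ez expr1n.
- case: j => [|j].
    by have -> : Negz 0 + 1 = Posz 0 by []; rewrite /Phi_seq /tau_word expn1.
  have -> : Negz j.+1 + 1 = Negz j.
    by rewrite !NegzE -[j.+2]addn1 PoszD opprD subrK.
  by rewrite /Phi_seq -exprM -expnSr.
Qed.

Definition Phi (x : R) (w : Omega N2) : solenoid R N :=
  exist (fun z => z \in solenoid_set N) (Phi_seq x w)
    (mem_set (Phi_seq_solenoid x w)).

(* The w with Phi x w = z. *)
Definition omega (x : R) (z : int -> R[i]) : Omega N2 :=
  xget point [set w | set_val (Phi x w) = z].

(* Real test functions suffice to determine m. *)
Definition is_solenoid_measure (P : R -> probability borel_Omega R)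
    (m : probability (borel_solenoid R N) R) : Prop :=
  forall f : solenoid R N -> R, continuous f ->
  (\int[m]_z (f z)%:E =
   \int[lebesgue_measure]_(x in `[0%R, 1%R[)
     \int[P x]_w (f (Phi x w))%:E)%E.

End Digits.

(* mu is the sum of its point masses. *)
Definition atomic d (T : measurableType d) (R : realType)
    (mu : {measure set T -> \bar R}) : Prop :=
  forall A, measurable A -> mu A = \esum_(t in A) mu [set t].

(* Main.v *)
Require Import Defs.
From HB Require Import structures.
From mathcomp Require Import all_boot all_order all_algebra.
From mathcomp Require Import complex.
From mathcomp Require Import all_classical all_reals all_analysis.
From mathcomp Require Import measurable_realfun.
From mathcomp Require Import ring lra zify.
Import Order.TTheory GRing.Theory Num.Theory.
Import numFieldNormedType.Exports.

(* Write a path of the walk with transition weights W = |m0|^2/N as a sequence of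
   circle points z_0, z_1, ..., each an N-th root of its predecessor. Near an m0-cycle
   the path that shadows the cycle backwards has positive probability, since m0 is
   Lipschitz and |m0| = sqrt N on the cycle. The set of starting points from which no
   such shadowing path can be reached with uniformly positive probability is closed
   and stable under preimages of positive weight. It omits an arc, and W has finitely
   many zeros, so multiplying the arc by powers of N shows that it is finite; a finite
   nonempty stable set contains an m0-cycle, a contradiction. By compactness of the
   circle there is one r > 0 such that every cylinder contains a point omega(x,i,a,k)
   carrying at least the fraction r of its mass, which forces P_x to be carried by
   these countably many points. For m one tests against continuous cutoffs of the
   coordinate z_l at distance comparable to N^-l from the cycles. *)

Local Open Scope classical_set_scope.
Local Open Scope ring_scope.

Set Implicit Arguments.
Unset Strict Implicit.
Unset Printing Implicit Defensive.

(** * The unit circle *)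

Local Notation normc := (@Normc.normc _).

Section UnitCircle.
Variable R : realType.
Implicit Types (x y t : R) (z : R[i]).

Lemma normE z : `|z| = (normc z)%:C%C. Proof. by []. Qed.

Lemma normc_eq1 z : (`|z| = 1) <-> (normc z = 1).
Proof. by rewrite normE; split=> [/complexI|->]. Qed.

Lemma normc_ge0 z : 0 <= normc z.
Proof. by case: z => a b; exact: sqrtr_ge0. Qed.

Lemma normc_ez t : normc (ez t) = 1.
Proof. exact/normc_eq1/norm_ez. Qed.

Lemma normcX z n : normc (z ^+ n) = normc z ^+ n.
Proof. by elim: n => [|n IH]; rewrite ?expr0 ?Normc.normc1// !exprS Normc.normcM IH. Qed.

Lemma normcB z w : normc (z - w) = normc (w - z).
Proof. by rewrite -(normcN (z - w)) opprB. Qed.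

Lemma ez_int (a : int) : ez (a%:~R : R) = 1.
Proof.
have ezn n : ez (n%:R : R) = 1 by rewrite ezMn ez1 expr1n.
case: a => n; first exact: ezn.
rewrite NegzE mulrNz.
have := ezD (n.+1%:R : R) (- n.+1%:R); rewrite subrr ez0 ezn mul1r => <-.
by [].
Qed.

Lemma ezDint t (a : int) : ez (t + a%:~R) = ez t.
Proof. by rewrite ezD ez_int mulr1. Qed.

Lemma sin_norm_le x : `|sin x| <= `|x|.
Proof.
wlog x0 : x / 0 <= x.
  move=> H; have [/H//|x0] := leP 0 x.
  by rewrite -normrN -sinN -(normrN x); apply: H; rewrite oppr_ge0 ltW.
have [|c _] := @MVT_segment R sin cos 0 x x0 (fun y _ => is_derive_sin y).
  by apply: continuous_subspaceT => y; exact: continuous_sin.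
rewrite sin0 !subr0 => ->; rewrite normrM.
by rewrite ler_piMl// cos_max.
Qed.

(** The chord formula: after squaring both sides it is the double angle formula for the cosine. *)
Lemma normc_ez_sub1 t : normc (ez t - 1) = 2 * `|sin (pi * t)|.
Proof.
apply/eqP; rewrite -(@eqrXn2 _ 2)// ?normc_ge0 ?mulr_ge0//.
have -> : normc (ez t - 1) ^+ 2 =
    (cos (2 * pi * t) - 1) ^+ 2 + sin (2 * pi * t) ^+ 2.
  rewrite /= sqr_sqrtr ?addr_ge0 ?sqr_ge0//.
  by rewrite subr0 sqrrN.
have E : 2 * pi * t = (pi * t) *+ 2 by rewrite -mulrA mulr_natl.
have := sin2cos2 (2 * pi * t) => ->.
rewrite exprMn real_normK ?num_real// E cos_mulr2n cos2sin2; apply/eqP; ring.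
Qed.

Lemma normc_ez_sub x y : normc (ez x - ez y) <= 2 * pi * `|x - y|.
Proof.
have -> : ez x - ez y = ez y * (ez (x - y) - 1).
  by rewrite mulrBr mulr1 -ezD (addrC y) subrK.
rewrite Normc.normcM normc_ez mul1r normc_ez_sub1 -mulrA ler_pM2l//.
by rewrite (le_trans (sin_norm_le _))// normrM ger0_norm// pi_ge0.
Qed.

Lemma ez_sub1_ge e t : 0 <= e -> e <= `|t| -> `|t| <= 1 / 2 ->
  2 * sin (pi * e) <= normc (ez t - 1).
Proof.
move=> e0 et t2; rewrite normc_ez_sub1 ler_pM2l//.
have sE : `|sin (pi * t)| = `|sin (pi * `|t|)|.
  by have [?|?] := ger0P t; rewrite ?mulrN ?sinN ?normrN.
have pi0 := pi_gt0 R.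
rewrite sE; apply: le_trans (ler_norm _).
have lt2 : pi * `|t| <= pi / 2 by rewrite ler_pM2l// -[2^-1]mul1r.
have h : - (pi / 2) <= (0 : R) by rewrite oppr_le0 divr_ge0// ltW.
have ee : pi * e <= pi * `|t| by rewrite ler_pM2l.
move: ee; rewrite le_eqVlt => /orP[/eqP->//|ee].
by rewrite ltW// ltr_sin// in_itv/=; apply/andP; split;
  rewrite ?(le_trans h)// ?mulr_ge0// ?(ltW pi0)// (le_trans (ltW ee)).
Qed.

(** The fractional part [s] of [t] satisfies sin (pi s) = 0 by the chord formula, while the sine is
    positive on the open interval from 0 to pi. *)
Lemma ez_eq1 t : ez t = 1 -> exists a : int, t = a%:~R.
Proof.
have pi0 := pi_gt0 R.
move=> h; exists (Num.floor t).
have /andP[f1 f2] := floor_itv t.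
set s := t - (Num.floor t)%:~R.
have es : ez s = 1.
  by rewrite /s -mulrNz ezDint.
have s0 : 0 <= s by rewrite subr_ge0.
have s1 : s < 1 by move: f2; rewrite intrD /s; lra.
apply/eqP; rewrite -subr_eq0 -/s; apply/negPn/negP => sN0.
have := normc_ez_sub1 s; rewrite es subrr Normc.normc0 => /eqP.
rewrite eq_sym mulf_eq0 pnatr_eq0/= normr_eq0 gt_eqF// sin_gt0_pi//.
rewrite mulr_gt0//= ?lt0r ?sN0//.
by rewrite gtr_pMr.
Qed.

Lemma ez_eq x y : ez x = ez y -> exists a : int, x = y + a%:~R.
Proof.
move=> h; have : ez (x - y) = 1.
  by rewrite ezD h -ezD subrr ez0.
by move=> /ez_eq1[a ha]; exists a; rewrite -ha addrC subrK.
Qed.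

Lemma ez_surj z : normc z = 1 -> exists t, ez t = z.
Proof.
have pi0 := pi_gt0 R.
case: z => a b /= ab1.
have ab : a ^+ 2 + b ^+ 2 = 1.
  by rewrite -[LHS]sqr_sqrtr ?addr_ge0 ?sqr_ge0// ab1 expr1n.
have a1 : -1 <= a <= 1.
  have : a ^+ 2 <= 1 by rewrite -ab lerDl sqr_ge0.
  move=> a21; rewrite -ler_norml -(ler_pXn2r (ltn0Sn 1)) ?nnegrE// expr1n.
  by rewrite real_normK ?num_real.
have cK := acosK a1.
have sK : sin (acos a) = `|b|.
  by rewrite sin_acos// -ab addrC addKr sqrtr_sqr.
have tpi t : 2 * pi * (t / (2 * pi)) = t.
  by rewrite mulrC divfK// mulf_neq0// gt_eqF.
have [b0|b0] := leP 0 b.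
- exists (- acos a / (2 * pi)); rewrite /ez tpi cosN sinN cK sK ger0_norm//.
  by rewrite opprK.
- exists (acos a / (2 * pi)); rewrite /ez tpi cK sK ltr0_norm//.
  by rewrite opprK.
Qed.

Lemma ez_surj_half z : normc z = 1 -> exists2 t, ez t = z & `|t| <= 1 / 2.
Proof.
move=> /ez_surj[t tz]; exists (t - (Num.floor (t + 1 / 2))%:~R).
  by rewrite -mulrNz ezDint.
have /andP[f1 f2] := floor_itv (t + 1 / 2).
by rewrite ler_norml; move: f1 f2; rewrite intrD; lra.
Qed.

(** A continuous logarithm near 1: the sine increases on [0, pi/2], so an argument in [-1/2, 1/2] of
    modulus at least [e] gives a chord of length at least 2 sin (pi e). *)
Lemma ez_small e : 0 < e -> exists2 d, 0 < d & forall z, normc z = 1 ->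
  normc (z - 1) < d -> exists2 t, ez t = z & `|t| < e.
Proof.
have pi0 := pi_gt0 R.
wlog e2 : e / e <= 1 / 2.
  move=> H e0; have [||d d0 hd] := H (Num.min e (1 / 2)).
  - by rewrite ge_min lexx orbT.
  - by rewrite lt_min e0; lra.
  exists d => // z z1 /(hd z z1)[t tz tm]; exists t => //.
  by move: tm; rewrite lt_min => /andP[].
move=> e0; exists (2 * sin (pi * e)).
  rewrite mulr_gt0// sin_gt0_pi// mulr_gt0//= gtr_pMr//; lra.
move=> z z1; have [t tz t2] := ez_surj_half z1.
move=> h; exists t => //; rewrite ltNge; apply/negP => et.
by have := @ez_sub1_ge e t (ltW e0) et t2; rewrite tz leNgt h.
Qed.

End UnitCircle.

(** * The weight of a filter *)

Section Weight.
Variables (R : realType) (N : nat) (N2 : (1 < N)%N) (m0 : R[i] -> R[i]).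
Implicit Types (x y t : R) (z w : R[i]) (k : 'I_N).

Definition weight z : R := normc (m0 z) ^+ 2 / N%:R.

Lemma weight_ge0 z : 0 <= weight z.
Proof. by rewrite /weight divr_ge0// exprn_ge0// normc_ge0. Qed.

Let N0 : (N%:R : R) != 0.
Proof. by rewrite pnatr_eq0 -lt0n ltnW. Qed.

Lemma ez_tauX k y : ez (tau k y) ^+ N = ez y.
Proof. by rewrite -ezMn -mulr_natr /tau divfK// -(ezDint y k). Qed.

Lemma root_circle w z : w ^+ N = z -> normc z = 1 -> normc w = 1.
Proof.
move=> <-; rewrite normcX => /eqP.
by rewrite pexpr_eq1 ?normc_ge0 ?(ltnW N2)// => /eqP.
Qed.

Lemma root_ez w y : w ^+ N = ez y -> exists k : 'I_N, w = ez (tau k y).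
Proof.
move=> wy; have [t tw] := ez_surj (root_circle wy (normc_ez y)).
move: wy; rewrite -tw -ezMn => /ez_eq[a ta].
have NN : (0 < N%:Z)%R by rewrite ltz_nat ltnW.
have /andP[r0 rN] : 0 <= (a %% N)%Z < N%:Z.
  by rewrite modz_ge0 ?gt_eqF//= ltz_pmod.
have rE : `|(a %% N)%Z|%N = (a %% N)%Z :> int by rewrite gez0_abs.
have rN' : (`|(a %% N)%Z|%N < N)%N by rewrite -ltz_nat rE.
(* Any argument of [w] is (y + a) / N for an integer [a]; the digit is [a] modulo N and the quotient
   disappears under [ez]. *)
exists (Ordinal rN'); rewrite /tau /=.
have -> : t = (y + `|(a %% N)%Z|%N%:R) / N%:R + (a %/ N)%Z%:~R.
  apply: (mulIf N0); rewrite mulrDl divfK// mulr_natr ta.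
  have cast : (`|(a %% N)%Z|%N%:R : R) = (a %% N)%Z%:~R by rewrite -[in RHS]rE.
  by rewrite cast {1}(divz_eq a N) intrD intrM; ring.
by rewrite ezDint.
Qed.

Lemma ez_tau_inj k k' y : ez (tau k y) = ez (tau k' y) -> k = k'.
Proof.
move=> /ez_eq[a]; rewrite /tau => h.
have {h} : (k%:R - k'%:R : R) = (a * N%:Z)%:~R.
  rewrite intrM -pmulrn; move/(congr1 (fun u => u * N%:R)): h.
  rewrite /= [in RHS]mulrDl !divfK// => h.
  by apply: (addrI (y + k'%:R)); rewrite -h; ring.
rewrite -[k%:R]/(k%:Z%:~R) -[k'%:R]/(k'%:Z%:~R) -intrB => /intr_inj h.
apply: val_inj => /=; have := ltn_ord k; have := ltn_ord k'.
have [a0|a0|a0] := ltgtP a 0; nia.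
Qed.

Hypothesis m0_ruelle : forall z, circle R z -> ruelle N m0 (fun=> 1) z = 1.

Lemma weight_sum y : \sum_(k < N) weight (ez (tau k y)) = 1.
Proof.
have := m0_ruelle (norm_ez y : circle R (ez y)); rewrite /ruelle.
have -> : [set w : R[i] | w ^+ N = ez y] =
          (fun k : 'I_N => ez (tau k y)) @` [set` index_enum 'I_N].
  apply/seteqP; split => w /=.
    by move=> /root_ez[k ->]; exists k => //=; rewrite mem_index_enum.
  by move=> [k _ <-]; exact: ez_tauX.
rewrite fsbig_image; last by move=> k k' _ _; exact: ez_tau_inj.
rewrite -fsbig_seq ?index_enum_uniq// => h; apply: complexI; rewrite -[RHS]h.
rewrite rmorph_sum mulr_sumr /=; apply: eq_bigr => k _.
by rewrite mulr1 mulrC /weight rmorphM fmorphV rmorphXn rmorph_nat.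
Qed.

Lemma weight_le1 z : normc z = 1 -> weight z <= 1.
Proof.
move=> z1; have [y zy] : exists y, ez y = z ^+ N.
  by apply: ez_surj; rewrite normcX z1 expr1n.
have [k ->] := root_ez (esym zy).
rewrite -(weight_sum y) (bigD1 k)//= lerDl sumr_ge0// => *; exact: weight_ge0.
Qed.

Lemma weight_root z : normc z = 1 ->
  exists w, [/\ normc w = 1, w ^+ N = z & 0 < weight w].
Proof.
move=> /ez_surj[y <-].
have [k k0] : exists k : 'I_N, 0 < weight (ez (tau k y)).
  apply: contrapT => /forallNP h; have := weight_sum y.
  rewrite big1 => [/esym/eqP|k _]; first by rewrite oner_eq0.
  by apply/eqP; rewrite eq_le weight_ge0 leNgt andbT; apply/negP/h.
by exists (ez (tau k y)); rewrite normc_ez ez_tauX.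
Qed.

(** The weights of the N-th roots of one point sum to 1, so a root that alone has positive weight
    carries all of it. *)
Lemma weight_eq1 w : normc w = 1 ->
  (forall w', normc w' = 1 -> w' ^+ N = w ^+ N -> 0 < weight w' -> w' = w) ->
  weight w = 1.
Proof.
move=> w1 h; have [y zy] : exists y, ez y = w ^+ N.
  by apply: ez_surj; rewrite normcX w1 expr1n.
have [k wk] := root_ez (esym zy).
rewrite -(weight_sum y) (bigD1 k)//= -wk big1 ?addr0// => k' kk'.
apply/eqP; rewrite eq_le weight_ge0 leNgt andbT; apply/negP => h'.
have := h _ (normc_ez _) _ h'; rewrite ez_tauX zy wk => /(_ erefl)/ez_tau_inj.
by move/eqP; rewrite (negbTE kk').
Qed.

Let Npos : (0 : R) < N%:R. Proof. by rewrite ltr0n ltnW. Qed.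

Lemma weight1P z : weight z = 1 <-> `|m0 z| = (Num.sqrt (N%:R : R))%:C%C.
Proof.
rewrite normE /weight; split => [h|/complexI ->].
  congr (_%:C)%C; rewrite -[LHS]ger0_norm ?normc_ge0// -sqrtr_sqr.
  by congr Num.sqrt; apply: (mulIf (invr_neq0 N0)); rewrite h divff.
by rewrite sqr_sqrtr ?ler0n// divff.
Qed.

Hypothesis m0_lipschitz : [lipschitz m0 z | z in circle R].

Lemma m0_lip : exists2 K : R, 0 < K & forall z w, normc z = 1 -> normc w = 1 ->
  normc (m0 z - m0 w) <= K * normc (z - w).
Proof.
have [M [Mreal HM]] := m0_lipschitz.
exists (normc M + 1); first by rewrite ltr_wpDl// normc_ge0.
move=> z w z1 w1.
have := HM (normc M + 1)%:C%C _ (z, w) _.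
rewrite /= !normE -rmorphM lecR; apply; last by split; exact/normc_eq1.
apply: le_lt_trans (_ : `|M| < _); first exact: real_ler_norm.
by rewrite normE ltcR ltrDl.
Qed.

Lemma m0_le z : normc z = 1 -> normc (m0 z) <= Num.sqrt N%:R.
Proof.
move=> z1; have := weight_le1 z1.
rewrite /weight ler_pdivrMr// mul1r => h.
by rewrite -[leLHS]ger0_norm ?normc_ge0// -sqrtr_sqr ler_wsqrtr.
Qed.

Lemma normc_dist z w : `|normc z - normc w| <= normc (z - w).
Proof.
have tri (u v : R[i]) : normc u - normc v <= normc (u - v).
  by rewrite lerBlDr -{1}(subrK v u) le_normcD.
by rewrite ler_norml tri andbT lerNl opprB normcB tri.
Qed.

(** Factor the difference of squares; [m0] is Lipschitz and bounded by sqrt N on the circle, whence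
    the factor 2 sqrt N. *)
Lemma weight_lip : exists2 K : R, 0 < K & forall z w, normc z = 1 ->
  normc w = 1 -> `|weight z - weight w| <= K * normc (z - w).
Proof.
have [K K0 HK] := m0_lip; have sN0 : 0 < Num.sqrt (N%:R : R) by rewrite sqrtr_gt0.
exists (K * (2 * Num.sqrt N%:R) / N%:R); first by rewrite divr_gt0// !mulr_gt0.
move=> z w z1 w1; rewrite /weight -mulrBl normrM normfV [`|N%:R|]ger0_norm//.
rewrite -!mulrA mulrCA [leRHS]mulrCA.
have -> : K * (2 * (Num.sqrt N%:R * (N%:R^-1 * normc (z - w)))) =
  (K * normc (z - w) * (2 * Num.sqrt N%:R)) / N%:R by ring.
rewrite ler_pM2r ?invr_gt0// subr_sqr normrM ler_pM//.
  exact: le_trans (normc_dist _ _) (HK _ _ z1 w1).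
rewrite (le_trans (ler_normD _ _))// mulr2n mulrDl !mul1r.
by rewrite lerD// ger0_norm ?normc_ge0// m0_le.
Qed.


End Weight.

(** * Cycles and their lines in the solenoid *)

Section Line.
Variables (R : realType) (N : nat) (N2 : (1 < N)%N).
Implicit Types (c : seq R[i]) (u : R) (k l : int).

(* The point z(x,i,a,k) is line (C i) k (x + a - theta k), see solenoid_ptE. *)
Definition line c k u : int -> R[i] :=
  fun l => cycle_pt c (k - l) * ez (u / N%:R ^ l).

Let N0 : (N%:R : R) != 0.
Proof. by rewrite pnatr_eq0 -lt0n ltnW. Qed.

Lemma cycle_index c k : (0 < size c)%N ->
  (`|(k %% (size c)%:Z)%Z|%N < size c)%N.
Proof.
move=> c0; have p0 : (size c)%:Z != 0 by rewrite eqz_nat -lt0n.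
by rewrite -ltz_nat gez0_abs ?modz_ge0// ltz_pmod// ltz_nat.
Qed.

Lemma cycle_pt_nat c j : (j < size c)%N -> cycle_pt c j%:Z = c`_j.
Proof. by move=> jc; rewrite /cycle_pt modz_nat modn_small. Qed.

Lemma cycle_pt_mod c k k' : (k = k' %[mod (size c)%:Z])%Z ->
  cycle_pt c k = cycle_pt c k'.
Proof. by rewrite /cycle_pt => ->. Qed.

Lemma normc_cycle_pt c k : is_cycle N c -> normc (cycle_pt c k) = 1.
Proof. by case=> c0 _ h _; apply/normc_eq1/h; exact: cycle_index. Qed.

Lemma cycle_ptX c k : is_cycle N c -> cycle_pt c k ^+ N = cycle_pt c (k + 1).
Proof.
case=> c0 _ _ h; have p0 : (size c)%:Z != 0 by rewrite eqz_nat -lt0n.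
rewrite /cycle_pt h ?cycle_index//; congr nth.
apply/eqP; rewrite -eqz_nat -modz_nat gez0_abs ?modz_ge0// intS addrC.
by rewrite gez0_abs ?modz_ge0// modzDml.
Qed.

Lemma line0 c k u : line c k u 0 = cycle_pt c k * ez u.
Proof. by rewrite /line subr0 expr0z divr1. Qed.

(** Renumbering coordinates keeps a point within the family of lines; iterated in [lineD], this lets
    a path that starts at the end of a word be extended back over the word. *)
Lemma lineS c k u l : line c (k + 1) (u * N%:R) (l + 1) = line c k u l.
Proof.
rewrite /line; congr (cycle_pt _ _ * ez _); first by ring.
by rewrite exprzDr ?unitfE// expr1z invfM mulrACA divff// mulr1.
Qed.

Lemma lineD c k u l (n : nat) :
  line c (k + n%:Z) (u * N%:R ^+ n) (l + n%:Z) = line c k u l.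
Proof.
elim: n => [|n IH]; first by rewrite !addr0 mulr1.
by rewrite exprSr mulrA -addn1 PoszD !addrA lineS IH.
Qed.

Lemma normc_line c k u l : is_cycle N c -> normc (line c k u l) = 1.
Proof.
by move=> cc; rewrite Normc.normcM normc_ez normc_cycle_pt// mulr1.
Qed.

Lemma lineX c k u l : is_cycle N c -> line c k u (l + 1) ^+ N = line c k u l.
Proof.
move=> cc; rewrite /line exprMn cycle_ptX// -ezMn; congr (cycle_pt _ _ * ez _).
  by ring.
rewrite exprzDr ?unitfE// expr1z invfM -[_ *+ N]mulr_natr -!mulrA mulVf//.
by rewrite mulr1.
Qed.

Lemma line_mod c k k' u l : (k = k' %[mod (size c)%:Z])%Z ->
  line c k u l = line c k' u l.
Proof.
by move=> h; congr (_ * _); apply: cycle_pt_mod; rewrite -modzDml h modzDml.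
Qed.

Lemma line_solenoid c k u : is_cycle N c -> solenoid_set N (line c k u).
Proof.
by move=> cc l; split; [exact/normc_eq1/normc_line | exact: lineX].
Qed.

Lemma line_dist c k u l : is_cycle N c ->
  normc (line c k u l - cycle_pt c (k - l)) <= 2 * pi * `|u| / N%:R ^ l.
Proof.
move=> cc; rewrite /line -[X in _ - X]mulr1 -mulrBr Normc.normcM.
rewrite normc_cycle_pt// mul1r -(ez0 R) (le_trans (normc_ez_sub _ _))//.
by rewrite subr0 normrM normfV [`|N%:R ^ l|]ger0_norm ?exprz_ge0// mulrA.
Qed.

End Line.

(** * Finite sets stable under preimages of positive weight *)

Section FiniteInvariant.
Variables (R : realType) (N : nat) (N2 : (1 < N)%N) (m0 : R[i] -> R[i]).
Hypothesis m0_ruelle : forall z, circle R z -> ruelle N m0 (fun=> 1) z = 1.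

(** Choosing for each point of [F] a root of positive weight gives an injection of [F] into itself,
    hence a bijection, whose inverse is the N-th power map. That map thus permutes [F], and each
    point of [F] is the only root of positive weight of its power, so its weight is 1. Every orbit
    of the permutation is then an [m0]-cycle. *)
Lemma finite_invariant_cycle (F : set R[i]) : finite_set F -> F !=set0 ->
  F `<=` circle R ->
  (forall w, normc w = 1 -> F (w ^+ N) -> 0 < weight N m0 w -> F w) ->
  exists2 c, is_m0_cycle N m0 c & forall z, z \in c -> F z.
Proof.
move=> /finite_seqP[s Fs] [z0 Fz0] Fcirc Finv.
have Fn z : F z -> normc z = 1 by move=> /Fcirc/normc_eq1.
have sF (x : seq_sub s) : F (ssval x) by rewrite Fs /=; exact: ssvalP.
have /choice[g gP] (x : seq_sub s) :
    exists y : seq_sub s, ssval y ^+ N = ssval x /\ 0 < weight N m0 (ssval y).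
  have [w [w1 wx w0]] := weight_root N2 m0_ruelle (Fn _ (sF x)).
  have Fw : F w by apply: Finv => //; rewrite wx.
  have ws : w \in s by move: Fw; rewrite Fs.
  by exists (SeqSub ws).
have g_inj : injective g.
  by move=> x y /(congr1 (fun u => ssval u ^+ N)); rewrite !(gP _).1 => /val_inj.
pose h := finv g.
have h_inj : injective h by exact: finv_inj.
have hX x : ssval (h x) = ssval x ^+ N.
  by rewrite -[in RHS](f_finv g_inj x) (gP _).1.
have z0s : z0 \in s by move: Fz0; rewrite Fs.
pose c := [seq ssval x | x <- orbit h (SeqSub z0s)].
have sc : size c = order h (SeqSub z0s) by rewrite size_map size_orbit.
have nc j : (j < size c)%N -> c`_j = ssval (iter j h (SeqSub z0s)).
  move=> jc; rewrite (nth_map (SeqSub z0s)) ?size_orbit -?sc//.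
  by rewrite /orbit nth_traject// -sc.
exists c; last by move=> z /mapP[x _ ->].
split.
  split => //.
  - by rewrite sc order_gt0.
  - by rewrite map_inj_uniq ?orbit_uniq//; exact: val_inj.
  - by move=> j jc; rewrite nc//; exact: Fcirc.
  - move=> j jc; rewrite nc// -hX -iterS.
    have [jc'|jc'] := ltnP j.+1 (size c); first by rewrite modn_small// nc.
    have -> : j.+1 = size c by apply/eqP; rewrite eqn_leq jc jc'.
    by rewrite modnn nc ?sc ?order_gt0// iter_order.
move=> j jc; apply/(weight1P N2 m0); rewrite nc//.
set x := iter _ _ _; apply: (weight_eq1 N2 m0_ruelle); first exact: Fn.
(* A competing root of positive weight lies in [F] by stability, and the power map is injective
   there. *)
move=> w w1 wx w0; have Fw : F w by apply: Finv => //; rewrite wx -hX.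
have ws : w \in s by move: Fw; rewrite Fs.
have : h (SeqSub ws) = h x by apply: val_inj; rewrite /= !hX.
by move=> /h_inj <-.
Qed.

End FiniteInvariant.

(** * Uniform lower bounds for the mass of shadowing paths *)

Section Good.
Variables (R : realType) (N : nat) (N2 : (1 < N)%N) (m0 : R[i] -> R[i]).
Hypothesis m0_lipschitz : [lipschitz m0 z | z in circle R].
Hypothesis m0_zeros : finite_set (circle R `&` [set z | m0 z = 0]).
Hypothesis m0_ruelle : forall z, circle R z -> ruelle N m0 (fun=> 1) z = 1.
Variables (n : nat) (C : 'I_n -> seq R[i]).
Hypotheses (n_gt0 : (0 < n)%N) (C_cycles : enumerates_m0_cycles N m0 C).
Implicit Types (t u y : R) (z w : R[i]).

Local Notation wt := (weight N m0).
Local Notation line := (line N).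

Let N0 : (N%:R : R) != 0.
Proof. by rewrite pnatr_eq0 -lt0n ltnW. Qed.

Let cyc i : is_cycle N (C i).
Proof. by case: C_cycles => /(_ i)[]. Qed.

(** The walk started at [z] follows some path shadowing a cycle with probability at least [r]: that
    probability is the limit of these products. The first factor is at coordinate 1 because the
    starting point costs nothing. *)
Definition good (r : R) z := exists (i : 'I_n) (k : int) (u : R),
  z = line (C i) k u 0 /\
  forall s, r <= \prod_(0 <= l < s) wt (line (C i) k u l.+1%:Z).

Lemma weight_cycle_pt i k : wt (cycle_pt (C i) k) = 1.
Proof.
case: C_cycles => /(_ i)[[c0 _ _ _] h] _.
exact/(weight1P N2)/h/cycle_index.
Qed.

(** From [w ^+ N] the walk moves to [w] at the cost of one factor [wt w], then follows the path from
    [w]. The term [d] in the minimum covers the empty product, as weights are at most 1. *)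
Lemma good_step r d w : 0 <= r -> 0 <= d -> good r w -> d <= wt w ->
  good (Num.min d (d * r)) (w ^+ N).
Proof.
move=> r0 d0 [i [k [u [-> hr]]]] dw.
exists i, (k + 1), (u * N%:R); split.
  by rewrite -(lineS N2 (C i) k u 0) (lineX N2)// add0r.
case=> [|s].
  rewrite big_geq// ge_min (le_trans dw)//.
  by rewrite (weight_le1 N2 m0_ruelle)// normc_line.
rewrite big_nat_recl// ge_min; apply/orP; right.
have E l : line (C i) (k + 1) (u * N%:R) l.+1%:Z = line (C i) k u l%:Z.
  by rewrite -addn1 PoszD lineS.
by rewrite E; under eq_bigr do rewrite E; rewrite ler_pM.
Qed.

(** At depth l the line is within 2 pi |u| / N^l of the cycle, where the weight is 1, so by the
    Lipschitz bound the weight loses at most A / 2^l with A = 2 pi K |u|. The choice of [d] makes A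
    at most 1/2. *)
Lemma near_good_cycle : exists2 d : R, 0 < d & forall i k u, `|u| < d ->
  good (1 / 2) (line (C i) k u 0).
Proof.
have [K K0 HK] := weight_lip N2 m0_ruelle m0_lipschitz.
have pi0 := pi_gt0 R.
have A0 : 0 < K * (2 * pi) by rewrite !mulr_gt0.
exists (1 / (2 * (K * (2 * pi)))); first by rewrite divr_gt0// mulr_gt0.
move=> i k u; rewrite ltr_pdivlMr ?mulr_gt0// => hu.
exists i, k, u; split => // s.
pose A := K * (2 * pi) * `|u|.
have A2 : A <= 1 / 2 by rewrite /A; nra.
have Age0 : 0 <= A by rewrite mulr_ge0// ltW.
(* The lower bound is 1 minus the sum of A / 2^l for l from 1 to s. The upper bound 1 ensures that a
   new factor lowers the product by no more than its own defect. *)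
suff H : 1 - A + A / 2 ^+ s <= \prod_(0 <= l < s) wt (line (C i) k u l.+1%:Z) <= 1.
  case/andP: H => H _; apply: le_trans H.
  have : 0 <= A / 2 ^+ s by rewrite divr_ge0// exprn_ge0.
  lra.
elim: s => [|s /andP[IH1 IH2]]; first by rewrite big_geq// expr0 divr1 subrK !lexx.
rewrite big_nat_recr//=.
set p := \prod_(_ <= _ < _) _ in IH1 IH2 *; set w := wt _.
have p0 : 0 <= p by apply: prodr_ge0 => *; exact: weight_ge0.
have w0 : 0 <= w by exact: weight_ge0.
have w1 : w <= 1 by apply: (weight_le1 N2 m0_ruelle); rewrite normc_line.
have wA : 1 - w <= A / 2 ^+ s.+1.
  have := HK (line (C i) k u s.+1%:Z) (cycle_pt (C i) (k - s.+1%:Z))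
    (normc_line _ _ _ (cyc i)) (normc_cycle_pt _ (cyc i)).
  rewrite weight_cycle_pt -/w distrC => /(le_trans (ler_norm _))/le_trans; apply.
  rewrite (le_trans (ler_wpM2l (ltW K0) (line_dist k u s.+1%:Z (cyc i))))//.
  have -> : K * (2 * pi * `|u| / N%:R ^ s.+1%:Z) = A / N%:R ^+ s.+1.
    by rewrite -exprnP /A !mulrA.
  rewrite ler_wpM2l// lef_pV2 ?posrE ?exprn_gt0 ?ltr0n ?(ltnW N2)//.
  by rewrite lerXn2r// ?nnegrE// ler_nat.
have E : A / 2 ^+ s = 2 * (A / 2 ^+ s.+1).
  by rewrite exprS invfM mulrCA [2 * _]mulrA divff// mul1r.
rewrite E in IH1; move: (A / 2 ^+ s.+1) IH1 wA => b IH1 wA.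
apply/andP; split; nra.
Qed.

(** A bound shared by a whole neighbourhood makes this set of angles open and lets compactness
    produce a single bound for the circle. *)
Definition good_near y := exists2 r : R, 0 < r & \forall y' \near y, good r (ez y').

Lemma good_near_open y : good_near y -> \forall y' \near y, good_near y'.
Proof.
by move=> [r r0 /near_join]; apply: filterS => y' ?; exists r.
Qed.

Lemma weight_ez_continuous : continuous (fun t : R => wt (ez t)).
Proof.
have [K K0 HK] := weight_lip N2 m0_ruelle m0_lipschitz.
have pi0 := pi_gt0 R.
move=> t; apply/cvgrPdist_le => e e0; near=> t'.
rewrite (le_trans (HK _ _ (normc_ez _) (normc_ez _)))//.
rewrite (le_trans (ler_wpM2l (ltW K0) (normc_ez_sub _ _)))// mulrA.
rewrite mulrC -ler_pdivlMr ?mulr_gt0//.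
near: t'; apply: cvgr_dist_le; last by rewrite divr_gt0// !mulr_gt0.
exact: cvg_id.
Unshelve. all: by end_near. Qed.

(** The inverse branch sending y to (y - a) / N is continuous, so [good_step] applies uniformly near
    the image of [t]; by continuity half of the weight at [t] is a lower bound nearby. *)
Lemma good_near_step t (a : int) : good_near t -> 0 < wt (ez t) ->
  good_near (t * N%:R + a%:~R).
Proof.
move=> [r r0 hr] w0; set d := wt (ez t) / 2.
have d0 : 0 < d by rewrite divr_gt0.
have dw : \forall t' \near t, d <= wt (ez t').
  apply: (cvgr_ge _ (@weight_ez_continuous t)).
  by rewrite /d ltr_pdivrMr// mulr_natr mulr2n ltrDl.
set p : R := t * N%:R + a%:~R.
have hc : ((y - a%:~R) / N%:R : R) @[y --> p] --> t.
  have {1}-> : t = (p - a%:~R) / N%:R by rewrite addrK mulfK.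
  by apply: cvgM; [apply: cvgB; [exact: cvg_id|exact: cvg_cst]|exact: cvg_cst].
exists (Num.min d (d * r)); first by rewrite lt_min d0 mulr_gt0.
have hcw : \forall y \near p, good r (ez ((y - a%:~R) / N%:R)) /\
    d <= wt (ez ((y - a%:~R) / N%:R)).
  exact: (hc (fun t' => good r (ez t') /\ d <= wt (ez t')) (filterI hr dw)).
apply: filterS hcw => y [gy wy].
suff -> : ez y = ez ((y - a%:~R) / N%:R) ^+ N.
  by apply: good_step => //; exact: ltW.
by rewrite -ezMn -[_ *+ N]mulr_natr divfK// -mulrNz ezDint.
Qed.

Lemma good_near_cycle i k t : ez t = cycle_pt (C i) k -> good_near t.
Proof.
move=> tk; have [d d0 hd] := near_good_cycle.
exists (1 / 2); first by rewrite divr_gt0.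
near=> y.
have -> : ez y = line (C i) k (y - t) 0 by rewrite line0 -tk -ezD addrC subrK.
apply: hd; rewrite distrC; near: y.
by apply: cvgr_dist_lt => //; exact: cvg_id.
Unshelve. all: by end_near. Qed.

(* A set of angles that is stable under preimages of positive weight and omits an
   interval omits, up to finitely many points, all the intervals obtained from it by
   iterated multiplication by N, hence is finite modulo 1. *)
Lemma bad_finite a b : a < b -> (forall t, a < t < b -> good_near t) ->
  finite_set (@ez R @` [set y | ~ good_near y]).
Proof.
move=> ab hab.
pose Z := circle R `&` [set z | m0 z = 0].
(* The exceptional set after one more multiplication by N: a point is lost only if its chosen
   preimage was exceptional or is a zero of [m0]. *)
pose E' E : set R[i] := (fun z => z ^+ N) @` (E `|` Z).
have E'fin E : finite_set E -> finite_set (E' E).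
  by move=> finE; apply: finite_image; rewrite finite_setU.
have E'P E t (e : int) : ~ E' E (ez (t * N%:R + e%:~R)) ->
    (~ E (ez t) -> good_near t) -> good_near (t * N%:R + e%:~R).
  move=> nE ht.
  have tN : ez t ^+ N = ez (t * N%:R + e%:~R).
    by rewrite -ezMn -[_ *+ N]mulr_natr ezDint.
  apply: good_near_step.
    by apply: ht => Et; apply: nE; exists (ez t) => //; left.
  rewrite lt_def weight_ge0 andbT; apply/negP => /eqP w0; apply: nE.
  exists (ez t) => //; right; split; first exact/norm_ez.
  apply: Normc.eq0_normc; move/eqP: w0.
  by rewrite /weight mulf_eq0 invr_eq0 (negbTE N0) orbF sqrf_eq0 => /eqP.
have NN : (0 : R) < N%:R by rewrite ltr0n ltnW.
have H k : exists2 E : set R[i], finite_set E &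
    forall t, a * N%:R ^+ k < t < b * N%:R ^+ k -> ~ E (ez t) -> good_near t.
  elim: k => [|k [E finE hE]].
    by exists set0 => // t; rewrite !mulr1 => /hab.
  exists (E' E); first exact: E'fin.
  move=> y hy nE; move: nE; rewrite -(divfK N0 y) -[_ * N%:R]addr0 => nE.
  apply: (E'P E _ 0 nE); apply: hE.
  by rewrite ltr_pdivlMr// ltr_pdivrMr// -!mulrA -exprSr.
have [k hk] : exists k : nat, 1 < (b - a) * N%:R ^+ k.
  exists (Num.trunc `|(b - a)^-1|).+1.
  rewrite -ltr_pdivrMl ?subr_gt0// mulr1 (le_lt_trans (ler_norm _))//.
  apply: (lt_le_trans (truncnS_gt _)).
  by rewrite -natrX ler_nat ltnW// ltn_expl.
have [E finE hE] := H k.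
apply: (sub_finite_set _ (E'fin _ finE)) => _ [y /= ngy <-].
apply: contrapT => nE; apply: ngy.
(* The interval has length greater than 1, so it contains the translate of y / N by this integer;
   multiplication by N sends that translate to [y] modulo 1. *)
pose e := Num.floor (a * N%:R ^+ k - y / N%:R) + 1.
have yE : y = (y / N%:R + e%:~R) * N%:R + (- (e * N%:Z))%:~R.
  by rewrite mulrDl divfK// mulrNz intrM -pmulrn addrK.
move: nE; rewrite {1 2}yE => nE; apply: (E'P E _ _ nE); apply: hE.
have /andP[] := floor_itv (a * N%:R ^+ k - y / N%:R).
rewrite -/e; move: hk; rewrite /e intrD /=; lra.
Qed.

(** The arc required by [bad_finite] is found around a point of a cycle, available since n > 0. If
    the bad set were nonempty, it would contain an [m0]-cycle; this cycle is listed among the [C i],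
    whose points are good. *)
Lemma all_good_near y : good_near y.
Proof.
apply: contrapT => ny.
pose B := @ez R @` [set y | ~ good_near y].
have [i0 [t0 t0E]] : exists i t, ez t = cycle_pt (C i) 0.
  exists (Ordinal n_gt0); apply: ez_surj; exact: normc_cycle_pt.
have [/= e e0 he] : nbhs t0 good_near.
  exact/good_near_open/(good_near_cycle t0E).
have finB : finite_set B.
  apply: (@bad_finite (t0 - e / 2) (t0 + e / 2)) => [|t ht].
    by rewrite ltrD2l gtrN// divr_gt0.
  by apply: he; rewrite /= distrC ltr_norml; move: ht; lra.
have B0 : B !=set0 by exists (ez y), y.
have Bcirc : B `<=` circle R by move=> _ [t _ <-]; exact: norm_ez.
have [|c cc cB] := finite_invariant_cycle N2 m0_ruelle finB B0 Bcirc.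
  move=> w w1 [t /= nt tw] w0; have [s sw] := ez_surj w1.
  exists s => //= gs; apply: nt.
  have [a ->] : exists a : int, t = s * N%:R + a%:~R.
    by apply: ez_eq; rewrite mulr_natr ezMn sw tw.
  by apply: good_near_step; rewrite ?sw.
have [[c0 _ _ _] _] := cc.
have [i [Cic _]] := C_cycles.2 c cc.
have : c`_0 \in C i by rewrite Cic mem_nth.
move=> /(nthP 0)[j jC jE].
have /cB[t /= nt tE] : c`_0 \in c by exact: mem_nth.
by apply: nt; apply: (@good_near_cycle i j%:Z); rewrite cycle_pt_nat// jE.
Qed.

(** [good] weakens as [r] decreases, so the local bounds hold for all small positive [r], and
    compactness of [0, 1] makes them simultaneous. *)
Lemma good_uniform : exists2 r : R, 0 < r & forall z, normc z = 1 -> good r z.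
Proof.
have gle r r' z : r' <= r -> good r z -> good r' z.
  move=> rr [i [k [u [zE h]]]]; exists i, k, u; split => // s.
  exact: le_trans (h s).
have h : \forall r \near (0 : R)^'+, forall y, `[0, 1]%classic y -> good r (ez y).
  have /compact_near_coveringP := @segment_compact R 0 1; apply => x _.
  have [r r0 hr] := all_good_near x.
  have hr' : \forall r' \near (0 : R)^'+, r' <= r by exact: nbhs_right_le.
  exists ([set y | good r (ez y)], [set r' | r' <= r]) => //.
  by move=> [y r'] [/= gy /gle]; apply.
have [r [r0 hr]] : exists r : R, 0 < r /\ forall y, `[0, 1]%classic y -> good r (ez y).
  near (0 : R)^'+ => r; exists r; split => //.
  by near: r.
exists r => // z /ez_surj[t <-].
rewrite -(ezDint t (- Num.floor t)); apply: hr.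
have /andP[] := floor_itv t.
by rewrite /= in_itv/= mulrNz intrD => h1 h2; lra.
Unshelve. all: by end_near. Qed.

End Good.

(** * Measures on the path space *)

Lemma measurable_range d (T : measurableType d) (f : nat -> T) :
  (forall t : T, measurable [set t]) -> measurable (range f).
Proof.
move=> mT; rewrite (_ : range f = \bigcup_n [set f n]); first exact: bigcup_measurable.
by apply/seteqP; split => w [k _] => [<-|->]; exists k.
Qed.

Section PathSpace.
Variables (R : realType) (N : nat) (N2 : (1 < N)%N).
Local Notation Om := (borel_Omega N2).
Implicit Types (s : seq 'I_N) (w : Om).

Definition cyl s : set Om := [set w | mkseq (w : Omega N2) (size s) = s].

Lemma tupleE M w : [tuple (w : Omega N2) (j : nat) | j < M] = mkseq w M :> seq 'I_N.
Proof. by rewrite /= /mkseq -val_enum_ord -map_comp. Qed.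

Lemma cyl_tuple M (v : M.-tuple 'I_N) w :
  cyl v w <-> [tuple (w : Omega N2) (j : nat) | j < M] = v.
Proof.
rewrite /cyl /= size_tuple; split => h; last first.
  by rewrite -h tupleE.
by apply: val_inj; rewrite -[RHS]h; exact: tupleE.
Qed.

Lemma cyl_rcons s k : cyl (rcons s k) = cyl s `&` [set w | (w : Omega N2) (size s) = k].
Proof.
apply/seteqP; split => w; rewrite /cyl /= size_rcons mkseqS.
  by move=> /rcons_inj[-> ->].
by move=> [-> ->].
Qed.

Lemma measurable_cyl s : measurable (cyl s).
Proof.
elim/last_ind: s => [|s k IH].
  by rewrite (_ : cyl [::] = setT)//; apply/seteqP.
rewrite cyl_rcons; apply: measurableI => //.
by apply: sub_sigma_algebra; exists (size s), k.
Qed.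

Lemma cyl_mkseq M w w' :
  cyl (mkseq (w : Omega N2) M) w' <-> mkseq (w' : Omega N2) M = mkseq w M.
Proof. by rewrite /cyl /= size_mkseq. Qed.

Lemma measurable_tuple_pred M (Q : pred (M.-tuple 'I_N)) :
  measurable [set w : Om | Q [tuple (w : Omega N2) (j : nat) | j < M]].
Proof.
rewrite (_ : [set w | _] = \bigcup_(v in [set` enum Q]) cyl v).
  by apply: fin_bigcup_measurable => // v _; exact: measurable_cyl.
apply/seteqP; split => w /=.
  move=> Qw; exists [tuple (w : Omega N2) (j : nat) | j < M].
    by rewrite /= mem_enum.
  exact/cyl_tuple.
move=> [v /=]; rewrite mem_enum => Qv /cyl_tuple h.
by rewrite /= (h : mktuple _ = v).
Qed.

Lemma set1_cyl w : [set w] = \bigcap_M cyl (mkseq (w : Omega N2) M).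
Proof.
apply/seteqP; split => [_ -> M _|w' h]; first exact/cyl_mkseq.
apply/funext => j; have /cyl_mkseq e := h j.+1 I.
by rewrite -(nth_mkseq (w 0) w' (ltnSn j)) e nth_mkseq.
Qed.

Lemma measurable_set1_path w : measurable [set w].
Proof.
by rewrite set1_cyl; apply: bigcap_measurable => // M _; exact: measurable_cyl.
Qed.

Lemma nonincreasing_cyl w : nonincreasing_seq (fun M => cyl (mkseq (w : Omega N2) M)).
Proof.
move=> a b ab; apply/subsetPset => w' /cyl_mkseq h; apply/cyl_mkseq.
apply: (@eq_from_nth _ (w 0)) => [|j]; rewrite !size_mkseq// => ja.
rewrite nth_mkseq// nth_mkseq//.
by rewrite -(nth_mkseq (w 0) w' (leq_trans ja ab)) h nth_mkseq// (leq_trans ja ab).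
Qed.

(** * Concentration on countably many paths *)

Section Concentration.
Variable P : probability Om R.

Lemma measure_cyl_sum M (Q : pred (M.-tuple 'I_N)) (A : set Om) :
  measurable A ->
  P (A `&` [set w | Q [tuple (w : Omega N2) (j : nat) | j < M]]) =
  (\sum_(v | Q v) P (A `&` cyl v))%E.
Proof.
move=> mA.
have -> : A `&` [set w | Q [tuple (w : Omega N2) (j : nat) | j < M]] =
    \bigcup_(v in [set` enum Q]) (A `&` cyl v).
  apply/seteqP; split => w /=.
    move=> [Aw Qw]; exists [tuple (w : Omega N2) (j : nat) | j < M].
      by rewrite /= mem_enum.
    by split => //; exact/cyl_tuple.
  by move=> [v]; rewrite /= mem_enum => Qv [Aw /cyl_tuple ->].
rewrite measure_fin_bigcup//.
- by rewrite -fsbig_seq ?enum_uniq// big_enum.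
- apply/trivIsetP => v v' _ _ /eqP vv'; apply/seteqP; split => // w.
  by move=> [[_ /cyl_tuple h] [_ /cyl_tuple h']]; apply: vv'; rewrite -h -h'.
- by move=> v _; apply: measurableI => //; exact: measurable_cyl.
Qed.

(* The first L points of the countable set form a closed set, whose complement is the
   increasing union over M of sets determined by the first M digits: on those sets the
   cylinder bound adds up, and then L tends to infinity. *)
Lemma concentrated_on_atoms (d : nat -> Om) (r : R) : 0 < r ->
  (forall s, r%:E * P (cyl s) <= P (range d `&` cyl s))%E ->
  P (~` range d) = 0%E.
Proof.
move=> r0 hr; set D := range d.
have mD : measurable D by apply: measurable_range; exact: measurable_set1_path.
have mDc : measurable (~` D) by exact: measurableC.
have fin A : measurable A -> P A \is a fin_num by move=> mA; exact: fin_num_measure.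
have r1 : r <= 1.
  have := hr [::]; rewrite (_ : cyl [::] = setT); last by apply/seteqP.
  rewrite setIT probability_setT mule1 -lee_fin => /le_trans; apply.
  exact: probability_le1.
(* The complement of [D] keeps at most the fraction 1 - r of the mass of each cylinder. *)
have hDc s : (P (~` D `&` cyl s) <= (1 - r)%:E * P (cyl s))%E.
  have mc := measurable_cyl s.
  have e : P (cyl s) = (P (~` D `&` cyl s) + P (D `&` cyl s))%E.
    by rewrite (measureDI P mc mD) setDE !(setIC (cyl s)).
  move: (hr s) e.
  rewrite -(fineK (fin _ mc)) -(fineK (fin _ (measurableI _ _ mD mc))).
  rewrite -(fineK (fin _ (measurableI _ _ mDc mc))) -!EFinM -EFinD !lee_fin.
  by move=> h1 [h2]; nra.
pose F L : set Om := [set w | forall j, (j < L)%N -> w <> d j].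
have mF L : measurable (F L).
  rewrite (_ : F L = \bigcap_(j in `I_L) ~` [set d j]).
    apply: bigcap_measurableType => j _.
    by apply: measurableC; exact: measurable_set1_path.
  by apply/seteqP; split => w h j /= jL; exact: h.
pose Q L M : pred (M.-tuple 'I_N) := fun v => [forall j : 'I_L, tval v != mkseq (d j) M].
pose E L M : set Om := [set w | Q L M [tuple (w : Omega N2) (j : nat) | j < M]].
have mE L M : measurable (E L M) by exact: measurable_tuple_pred.
have EF L M : E L M `<=` F L.
  move=> w /= /forallP h j jL wd; have /eqP := h (Ordinal jL); apply.
  by rewrite tupleE wd.
have step L : (P (~` D) <= (1 - r)%:E * P (F L))%E.
  have DE : ~` D = \bigcup_M (~` D `&` E L M).
    apply/seteqP; split => [w Dw|w [M _ []]//].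
    suff [M hM] : exists M, forall j : 'I_L, mkseq w M != mkseq (d j) M.
      by exists M => //; split => //; apply/forallP => j; rewrite tupleE.
    have /choice[M hM] (j : 'I_L) : exists M, forall M', (M <= M')%N ->
        mkseq w M' != mkseq (d j) M'.
      have wd : w <> d j by move=> wd; apply: Dw; exists j.
      have [i hi] : exists i, w i <> d j i.
        by apply: contrapT => /forallNP h; apply: wd; apply/funext => i;
          exact: (contrapT (h i)).
      exists i.+1 => M iM; apply/eqP => /(congr1 (fun s => nth (w 0) s i)).
      by rewrite !nth_mkseq.
    exists (\max_j M j)%N => j; apply: hM; exact: leq_bigmax.
  have : P \o (fun M => ~` D `&` E L M) @ \oo --> P (~` D).
    rewrite [in X in _ --> X]DE; apply: nondecreasing_cvg_mu.
    - by move=> M; exact: measurableI.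
    - by rewrite -DE.
    - move=> a b ab; apply/subsetPset => w [Dw /forallP h]; split => //.
      apply/forallP => j; have := h j; rewrite !tupleE; apply: contra => /eqP e.
      apply/eqP; have /(congr1 (take a)) := e.
      by rewrite /mkseq -!map_take take_iota (minn_idPl ab).
  move=> /cvg_lim <-//; apply: lime_le.
    apply: ereal_nondecreasing_is_cvgn => a b ab /=.
    apply: le_measure; rewrite ?inE; do ?exact: measurableI.
    move=> w [Dw /forallP h]; split => //.
    apply/forallP => j; have := h j; rewrite !tupleE; apply: contra => /eqP e.
    apply/eqP; have /(congr1 (take a)) := e.
    by rewrite /mkseq -!map_take take_iota (minn_idPl ab).
  apply: nearW => M /=; rewrite measure_cyl_sum//.
  apply: (@le_trans _ _ ((1 - r)%:E * P (E L M))%E).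
    rewrite -[E L M]setTI measure_cyl_sum// ge0_sume_distrr//.
    by apply: lee_sum => v _; rewrite setTI.
  by apply: lee_wpmul2l; rewrite ?lee_fin ?subr_ge0//; apply: le_measure; rewrite ?inE.
have : P \o F @ \oo --> P (~` D).
  have -> : ~` D = \bigcap_L F L.
    apply/seteqP; split => w h.
      by move=> L _ j _ wd; apply: h; exists j.
    by move=> [j _ jw]; apply: (h j.+1 I j (ltnSn j)).
  apply: nonincreasing_cvg_mu => //.
  - by rewrite (le_lt_trans (probability_le1 _ _))// ltry.
  - exact: bigcap_measurable.
  - by move=> a b ab; apply/subsetPset => w h j ja; apply: h; exact: leq_trans ab.
(* The sets [F L] decrease to the complement of [D], whose mass is therefore at most 1 - r times
   itself, hence zero. *)
move=> PF; have : (P (~` D) <= (1 - r)%:E * P (~` D))%E.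
  have cv := cvgeZl (y := (1 - r)%:E) erefl PF.
  rewrite -(cvg_lim _ cv)//; apply: lime_ge.
    by apply/cvg_ex; eexists; exact: cv.
  by apply: nearW => L; exact: step.
rewrite -(fineK (fin _ mDc)) -EFinM lee_fin => h; congr EFin.
have : 0 <= fine (P (~` D)) by exact: fine_ge0.
by move=> h0; nra.
Qed.

End Concentration.
End PathSpace.
Arguments cyl {N} N2 s.

(** * Coding paths by digits *)

Section Coding.
Variables (R : realType) (N : nat) (N2 : (1 < N)%N).
Implicit Types (s t : seq 'I_N) (w : Omega N2) (x : R) (z : int -> R[i]).

Lemma ez_tau_word_rcons x s k :
  ez (tau_word x (rcons s k)) ^+ N = ez (tau_word x s).
Proof. by rewrite /tau_word foldl_rcons ez_tauX. Qed.

(** The N-th power of the last point is the point before it, which gives equal prefixes by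
    induction; the last digits then agree because the N roots are distinct. *)
Lemma tau_word_inj x s t : size s = size t ->
  ez (tau_word x s) = ez (tau_word x t) -> s = t.
Proof.
elim/last_ind: s t => [|s k IH] t; elim/last_ind: t => [|t k' _] //.
- by rewrite size_rcons.
- by rewrite size_rcons.
rewrite !size_rcons => -[st] e.
have st' : s = t by apply: IH => //; rewrite -(ez_tau_word_rcons x s k) e ez_tau_word_rcons.
move: e; rewrite st' /tau_word !foldl_rcons => /(ez_tau_inj N2) -> //.
Qed.

Lemma solenoid_word z x s : solenoid_set N z ->
  z (size s)%:Z = ez (tau_word x s) ->
  forall j, (j <= size s)%N -> z j%:Z = ez (tau_word x (take j s)).
Proof.
move=> zs; elim/last_ind: s => [|s k IH]; first by move=> h [|].
rewrite size_rcons => h j; rewrite leq_eqVlt => /orP[/eqP ->|].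
  by rewrite h -(size_rcons s k) take_size.
rewrite ltnS => js; rewrite -cats1 takel_cat//; apply: IH => //.
by rewrite -(ez_tau_word_rcons x s k) -h -addn1 PoszD (zs _).2.
Qed.

Lemma Phi_seq_surj z x : solenoid_set N z -> z 0 = ez x ->
  exists w, Phi_seq x w = z.
Proof.
move=> zs z0.
have /choice[g gP] s : exists k : 'I_N, ez (tau_word x s) = z (size s)%:Z ->
    ez (tau_word x (rcons s k)) = z (size s).+1%:Z.
  (* The choice function must be total; on words that do not lead to the coordinate of [z] it takes
     the digit 0. *)
  have [e|//] := pselect (ez (tau_word x s) = z (size s)%:Z); last first.
    by exists (Ordinal (ltnW N2)).
  have [k hk] : exists k : 'I_N, z (size s).+1%:Z = ez (tau k (tau_word x s)).
    by apply: (root_ez N2); rewrite e -addn1 PoszD (zs _).2.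
  by exists k => _; rewrite hk /tau_word foldl_rcons.
(* Prefixes grow by one chosen digit at a time, and [w] reads off the digits so appended. *)
pose f j := iter j (fun s => rcons s (g s)) [::].
pose w : Omega N2 := fun j => g (f j).
have fw j : mkseq w j = f j by elim: j => // j IH; rewrite mkseqS IH.
have fz j : ez (tau_word x (f j)) = z j%:Z.
  elim: j => [|j IH]; first by rewrite z0.
  have sf : size (f j) = j by rewrite -fw size_mkseq.
  by rewrite /= gP sf.
exists w; apply/funext => -[j|j]; first by rewrite /Phi_seq fw fz.
elim: j => [|j IH].
  by rewrite /Phi_seq expn1 -z0 -(zs (Negz 0)).2.
rewrite -(zs (Negz j.+1)).2.
have -> : Negz j.+1 + 1 = Negz j.
  by rewrite !NegzE -[j.+2]addn1 PoszD opprD subrK.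
by rewrite -IH /Phi_seq -exprM -expnSr.
Qed.

Lemma Phi_seq_nat x w (j : nat) : Phi_seq x w j%:Z = ez (tau_word x (mkseq w j)).
Proof. by []. Qed.

Lemma omegaK z x : solenoid_set N z -> z 0 = ez x ->
  Phi_seq x (omega N2 x z) = z.
Proof.
move=> zs z0; have [w wz] := Phi_seq_surj zs z0.
rewrite /omega; case: xgetP => [w' _ //|/(_ w)] h.
by exfalso; apply: h.
Qed.

Lemma solenoid_ptE (c : seq R[i]) theta x a k : is_argument c theta ->
  solenoid_pt N theta x a k = line N c k (x + a%:~R - theta k).
Proof.
move=> h; apply/funext => l; rewrite /solenoid_pt /line ezD mulrC.
by rewrite (h (k - l)).2.
Qed.

Lemma solenoid_pt0 (c : seq R[i]) theta x a k : is_argument c theta ->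
  solenoid_pt N theta x a k 0 = ez x.
Proof.
by move=> h; rewrite /solenoid_pt expr0z divr1 subr0 subrK ezDint.
Qed.

(** Since [ez] agrees at u + theta k and at x, these differ by an integer, which is [a]; the phase
    matters only modulo the length of the cycle. *)
Lemma line_solenoid_pt (c : seq R[i]) theta x k u : is_cycle N c ->
  is_argument c theta -> line N c k u 0 = ez x ->
  exists (a : int) (j : nat), (j < size c)%N /\
    line N c k u = solenoid_pt N theta x a j%:Z.
Proof.
move=> cc h; rewrite line0 -(h k).2 -ezD => /ez_eq[a ha].
have [c0 _ _ _] := cc.
have p0 : (size c)%:Z != 0 by rewrite eqz_nat -lt0n.
have kE : (`|(k %% (size c)%:Z)%Z|%N)%:Z = (k %% (size c)%:Z)%Z.
  by rewrite gez0_abs ?modz_ge0.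
exists a, `|(k %% (size c)%:Z)%Z|%N; split; first exact: cycle_index.
rewrite (solenoid_ptE _ _ _ h) kE -(h k).1.
have -> : u = x + a%:~R - theta k by rewrite -ha addrC addKr.
by apply/funext => l; apply: line_mod; rewrite modz_mod.
Qed.

End Coding.

(** * Masses of cylinders and points *)

Section PathMeasure.
Variables (R : realType) (N : nat) (N2 : (1 < N)%N) (m0 : R[i] -> R[i]).
Variables (x : R) (P : probability (borel_Omega N2) R).
Hypothesis P_path : is_path_measure m0 x P.

Lemma path_cyl (s : seq 'I_N) : P (cyl N2 s) =
  (\prod_(0 <= j < size s) weight N m0 (ez (tau_word x (take j.+1 s))))%:E.
Proof.
have := P_path (fun v : (size s).-tuple 'I_N => (v == in_tuple s)%:R).
rewrite (bigD1 (in_tuple s))//= eqxx mul1r [X in _ + X]big1 ?addr0; last first.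
  by move=> v vs; rewrite (negbTE vs) mul0r.
rewrite big_mkord => <-; rewrite -[X in P X]setIT -integral_indic//.
  apply: eq_integral => w _; congr EFin; rewrite indicE; congr (_%:R).
  congr nat_of_bool.
  by apply/idP/eqP; rewrite inE => /(cyl_tuple (in_tuple s) w).
exact: measurable_cyl.
Qed.

(** A path is the decreasing intersection of the cylinders of its prefixes, whose masses are these
    products. *)
Lemma path_set1_cvg (w : Omega N2) z : Phi_seq x w = z ->
  (\prod_(0 <= j < M) weight N m0 (z j.+1%:Z))%:E @[M --> \oo] --> P [set w].
Proof.
move=> wz.
have : P \o (fun M => cyl N2 (mkseq w M)) @ \oo --> P [set w].
  rewrite (set1_cyl w); apply: nonincreasing_cvg_mu.
  - by rewrite (le_lt_trans (probability_le1 _ _))// ?ltry//; exact: measurable_cyl.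
  - by move=> M; exact: measurable_cyl.
  - by rewrite -set1_cyl; exact: measurable_set1_path.
  - exact: nonincreasing_cyl.
apply: cvg_trans; apply: near_eq_cvg; apply: nearW => M /=.
rewrite path_cyl size_mkseq; congr EFin; apply: eq_big_nat => j /andP[_ jM].
by rewrite -wz Phi_seq_nat /mkseq -map_take take_iota (minn_idPl jM).
Qed.

End PathMeasure.

(** * The infinite product *)

Section ComplexLimits.
Variable R : realType.

Lemma posC (e : R[i]) : 0 < e -> 0 < complex.Re e /\ e = (complex.Re e)%:C%C.
Proof. by case: e => a b; rewrite ltcE /= => /andP[/eqP -> ->]. Qed.

Lemma normc_sub_continuous (c : R[i]) : continuous (fun z : R[i] => normc (z - c) : R).
Proof.
move=> z A /nbhs_ballP[e /= e0 eA].
exists e%:C%C => /=; first by rewrite ltcR.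
move=> w; rewrite /ball_ /= normE ltcR => zw.
apply: eA; rewrite /ball /=; apply: le_lt_trans (normc_dist _ _) _.
by have -> : z - c - (w - c) = z - w by ring.
Qed.

Lemma normc_continuous : continuous (fun z : R[i] => normc z : R).
Proof.
have -> : (fun z : R[i] => normc z : R) = (fun z => normc (z - 0)).
  by apply/funext => z; rewrite subr0.
exact: normc_sub_continuous.
Qed.

Lemma cvg_complex (p : nat -> R[i]) (l : R[i]) :
  normc (l - p n) @[n --> \oo] --> (0 : R) -> p n @[n --> \oo] --> l.
Proof.
move=> h; apply/cvgrPdist_lt => e /posC[e0 ->]; near=> n.
rewrite normE ltcR -[normc _]ger0_norm ?normc_ge0// -normrN -sub0r.
by near: n; apply: cvgr_dist_lt.
Unshelve. all: by end_near. Qed.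

Lemma normc_le_ReIm (z : R[i]) : normc z <= `|complex.Re z| + `|complex.Im z|.
Proof.
case: z => a b /=; rewrite -[leRHS]ger0_norm ?addr_ge0// -sqrtr_sqr ler_wsqrtr//.
rewrite sqrrD !real_normK ?num_real//.
by rewrite addrAC lerDl mulrn_wge0// mulr_ge0.
Qed.

Lemma Re_le_normc (z : R[i]) : `|complex.Re z| <= normc z.
Proof. by rewrite -lecR; exact: normc_ge_Re. Qed.

Lemma Im_le_normc (z : R[i]) : `|complex.Im z| <= normc z.
Proof. by case: z => a b /=; rewrite -sqrtr_sqr ler_wsqrtr// lerDr sqr_ge0. Qed.

Lemma cvg_geometric_steps (a : nat -> R) (K : R) : 0 <= K ->
  (forall n, `|a n.+1 - a n| <= K / 2 ^+ n) -> cvgn a.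
Proof.
move=> K0 h.
have -> : a = cst (a 0%N) + series (telescope a).
  by apply/funext => n; rewrite eq_sum_telescope.
apply: is_cvgD; first exact: is_cvg_cst.
apply: normed_cvg; apply: (@series_le_cvg _ _ (geometric K 2^-1)).
- by move=> n /=.
- by move=> n; rewrite /= mulr_ge0.
- by move=> n; rewrite /= exprVn; exact: h.
- by apply: is_cvg_geometric_series; rewrite ger0_norm// invf_lt1// ltr1n.
Qed.

Lemma complex_cvg_geometric_steps (p : nat -> R[i]) (K : R) : 0 <= K ->
  (forall n, normc (p n.+1 - p n) <= K / 2 ^+ n) ->
  exists l : R[i], p n @[n --> \oo] --> l.
Proof.
move=> K0 h.
have cRe : cvgn (fun n => complex.Re (p n)).
  apply: (cvg_geometric_steps K0) => n; apply: le_trans (h n).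
  by rewrite -raddfB; exact: Re_le_normc.
have cIm : cvgn (fun n => complex.Im (p n)).
  apply: (cvg_geometric_steps K0) => n; apply: le_trans (h n).
  by rewrite -raddfB; exact: Im_le_normc.
set a := limn (fun n => complex.Re (p n)); set b := limn (fun n => complex.Im (p n)).
exists (a +i* b)%C; apply: cvg_complex.
apply: (@squeeze_cvgr _ _ _ _ (cst 0) (fun n => `|a - complex.Re (p n)| + `|b - complex.Im (p n)|)).
- by apply: nearW => n; rewrite normc_ge0 /= (le_trans (normc_le_ReIm _))// !raddfB.
- exact: cvg_cst.
- rewrite -[X in _ --> X]addr0; apply: cvgD.
    rewrite -(normr0 R) -(subrr a); apply: cvg_norm; apply: cvgB => //.
    exact: cvg_cst.
  rewrite -(normr0 R) -(subrr b); apply: cvg_norm; apply: cvgB => //.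
  exact: cvg_cst.
Qed.

End ComplexLimits.

Section PhiHat.
Variables (R : realType) (N : nat) (N2 : (1 < N)%N) (m0 : R[i] -> R[i]).
Hypothesis m0_lipschitz : [lipschitz m0 z | z in circle R].
Hypothesis m0_ruelle : forall z, circle R z -> ruelle N m0 (fun=> 1) z = 1.
Variables (c : seq R[i]) (theta : int -> R).
Hypotheses (cc : is_m0_cycle N m0 c) (ctheta : is_argument c theta).

(** The squared moduli of the partial products of [phi_hat] are the products of weights. As
    [phi_hat] is a [limn], the complex products must be shown to converge: they have modulus at most
    1 and their factors approach 1 geometrically. *)
Lemma phi_hat_cvg k u :
  \prod_(0 <= l < M) weight N m0 (line N c k u l.+1%:Z) @[M --> \oo] -->
  normc (phi_hat N m0 c theta k u) ^+ 2.
Proof.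
have [K K0 HK] := m0_lip m0_lipschitz.
have sN : 0 < Num.sqrt (N%:R : R) by rewrite sqrtr_gt0 ltr0n ltnW.
have pi0 := pi_gt0 R.
have cyc := cc.1; have [c0 _ _ _] := cyc.
pose f l := ((alpha N m0 c (k - l%:Z))^* * m0 (ez (u / N%:R ^+ l + theta (k - l%:Z)))
      / (Num.sqrt (N%:R : R))%:C)%C.
pose p n := \prod_(1 <= l < n.+1) f l.
have lineE l : ez (u / N%:R ^+ l + theta (k - l%:Z)) = line N c k u l%:Z.
  by rewrite ezD mulrC (ctheta _).2.
have a1 l : normc (alpha N m0 c l) = 1.
  rewrite /alpha Normc.normcM Normc.normcV.
  have := cc.2 _ (cycle_index l c0); rewrite normE => /complexI ->.
  by rewrite /= expr0n addr0 sqrtr_sqr ger0_norm ?ltW// divff// gt_eqF.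
have ncJ (z : R[i]) : normc (z^*)%C = normc z.
  by case: z => a b /=; rewrite sqrrN.
have ncC : normc (Num.sqrt (N%:R : R))%:C%C = Num.sqrt N%:R.
  by rewrite /= expr0n addr0 sqrtr_sqr ger0_norm ?ltW.
have nf l : normc (f l) ^+ 2 = weight N m0 (line N c k u l%:Z).
  rewrite /f lineE !Normc.normcM Normc.normcV ncJ a1 mul1r ncC expr_div_n.
  by rewrite sqr_sqrtr ?ler0n.
have np n : normc (p n) ^+ 2 = \prod_(0 <= l < n) weight N m0 (line N c k u l.+1%:Z).
  rewrite /p; elim: n => [|n IH]; first by rewrite !big_geq// Normc.normc1 expr1n.
  by rewrite big_nat_recr//= [in RHS]big_nat_recr//= Normc.normcM exprMn IH nf.
have p1 n : normc (p n) <= 1.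
  rewrite -(ler_pXn2r (ltn0Sn 1)) ?nnegrE ?normc_ge0// expr1n np.
  apply: prodr_ile1 => l _; rewrite weight_ge0/=.
  by apply: (weight_le1 N2 m0_ruelle); rewrite normc_line.
have f1 l : normc (f l - 1) <= K * (2 * pi * `|u|) / Num.sqrt N%:R / 2 ^+ l.
  (* On the cycle itself the factor is |alpha|^2 = 1, so this is a difference of two values of [m0],
     to which the Lipschitz bound applies. *)
  have -> : f l - 1 = ((alpha N m0 c (k - l%:Z))^*)%C *
      ((m0 (line N c k u l%:Z) - m0 (cycle_pt c (k - l%:Z))) / (Num.sqrt (N%:R : R))%:C%C).
    rewrite /f lineE mulrBl mulrBr mulrA; congr (_ - _).
    rewrite -/(alpha N m0 c (k - l%:Z)) mulrC -sqr_normc normE a1.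
    by rewrite expr1n.
  rewrite !Normc.normcM Normc.normcV ncJ a1 mul1r ncC.
  rewrite [leRHS]mulrAC ler_pM2r ?invr_gt0//.
  apply: (le_trans (HK _ _ (normc_line _ _ _ cyc) (normc_cycle_pt _ cyc))).
  rewrite -[leRHS]mulrA ler_pM2l//; apply: (le_trans (line_dist _ _ _ cyc)).
  rewrite -exprnP ler_wpM2l ?mulr_ge0 ?(ltW pi0)//.
  rewrite lef_pV2 ?posrE ?exprn_gt0 ?ltr0n ?(ltnW N2)//.
  by rewrite lerXn2r// ?nnegrE// ler_nat.
have A0 : 0 <= K * (2 * pi * `|u|) / Num.sqrt N%:R.
  by rewrite divr_ge0 ?(ltW sN)// mulr_ge0 ?(ltW K0)// mulr_ge0// mulr_ge0// ltW.
have [//||] := @complex_cvg_geometric_steps _ p (K * (2 * pi * `|u|) / Num.sqrt N%:R).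
  move=> n; rewrite /p big_nat_recr//= -/(p n) -[X in _ - X]mulr1 -mulrBr.
  rewrite Normc.normcM (le_trans (ler_piMl (normc_ge0 _) (p1 n)))//.
  apply: (le_trans (f1 _)); rewrite ler_wpM2l//.
  rewrite lef_pV2 ?posrE ?exprn_gt0//.
  by rewrite exprS ler_peMl ?exprn_ge0// ler1n.
move=> l pl.
have -> : phi_hat N m0 c theta k u = l.
  by apply: cvg_lim; [exact: norm_hausdorff | exact: pl].
have : normc (p n) ^+ 2 @[n --> \oo] --> normc l ^+ 2.
  have h : normc (p n) @[n --> \oo] --> normc l.
    exact: (cvg_comp _ _ pl (@normc_continuous R l)).
  by under eq_fun do rewrite expr2; rewrite expr2; exact: cvgM.
by under eq_fun do rewrite np.
Qed.

End PhiHat.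

(** * The path measures *)

Lemma atomic_range d (T : measurableType d) (R : realType)
    (P : probability T R) (f : nat -> T) :
  (forall t : T, measurable [set t]) -> P (~` range f) = 0%E -> atomic P.
Proof.
move=> mT Pf; set D := range f.
have mD : measurable D by exact: measurable_range.
move=> A mA.
have PD B : measurable B -> B `<=` ~` D -> P B = 0%E.
  move=> mB BD; apply/eqP; rewrite -measure_le0 -Pf.
  by apply: le_measure => //; rewrite inE//; exact: measurableC.
(* Only the first index of each value is kept, so that [f] becomes injective and the mass of A is a
   sum over indices without repetition. *)
pose K := [set n | A (f n) /\ forall k, (k < n)%N -> f k <> f n].
have fK : set_bij K (A `&` D) f.
  split.
  - by move=> n [An _]; split => //; exists n.
  - move=> a b; rewrite !inE => -[_ ha] [_ hb] fab.
    have [ab|ab|//] := ltngtP a b; first by case: (hb _ ab).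
    by case: (ha _ ab).
  - move=> t [At [k _ kt]].
    have ex : exists k, `[< f k = t >] by exists k; exact/asboolP.
    case: (ex_minnP ex) => j /asboolP jt jmin.
    exists j => //; split; first by rewrite jt.
    move=> l lj; rewrite jt => lt; have := jmin l; rewrite leqNgt lj.
    by move=> /(_ (asboolT lt)).
rewrite (esumID D)//= [X in (_ + X)%E]esum1 ?adde0; last first.
  by move=> t [_ Dt]; apply: PD => // _ ->.
rewrite (@reindex_esum _ _ _ _ _ _ _ fK).
have -> : P A = P (A `&` D).
  by rewrite (measureDI P mA mD) [X in (X + _)%E]PD ?add0e//; exact: measurableD.
have -> : A `&` D = \bigcup_(n in K) [set f n].
  have [fun_f _ surj_f] := fK.
  apply/seteqP; split => [t /surj_f[n Kn <-]|_ [n Kn ->]]; first by exists n.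
  exact: fun_f.
rewrite (measure_bigcup P)//; last first.
  apply/trivIsetP => a b Ka Kb ab; apply/seteqP; split => // t [-> fab].
  by case/eqP: ab; have [_ inj _] := fK; apply: inj; rewrite ?inE.
by rewrite nneseries_esum//; congr esum; apply/seteqP; split => k /=; rewrite inE.
Qed.

Section PathMeasureIsAtomic.
Variables (R : realType) (N : nat) (N2 : (1 < N)%N) (m0 : R[i] -> R[i]).
Hypothesis m0_lipschitz : [lipschitz m0 z | z in circle R].
Hypothesis m0_zeros : finite_set (circle R `&` [set z | m0 z = 0]).
Hypothesis m0_ruelle : forall z, circle R z -> ruelle N m0 (fun=> 1) z = 1.
Variables (n : nat) (C : 'I_n -> seq R[i]).
Hypotheses (n_gt0 : (0 < n)%N) (C_cycles : enumerates_m0_cycles N m0 C).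
Variable theta : 'I_n -> int -> R.
Hypothesis theta_arg : forall i, is_argument (C i) (theta i).
Variables (x : R) (P : probability (borel_Omega N2) R).
Hypothesis P_path : is_path_measure m0 x P.

Let pt (i : 'I_n) (a : int) (k : nat) : Omega N2 :=
  omega N2 x (solenoid_pt N (theta i) x a k%:Z).

Lemma Phi_seq_pt i a k :
  Phi_seq x (pt i a k) = line N (C i) k%:Z (x + a%:~R - theta i k%:Z).
Proof.
rewrite omegaK (solenoid_ptE _ _ _ _ (theta_arg i))//.
  by apply: line_solenoid => //; case: C_cycles => /(_ i)[].
by rewrite -(solenoid_ptE _ _ _ _ (theta_arg i)) (solenoid_pt0 _ _ _ _ (theta_arg i)).
Qed.

Lemma path_atom i a k : P [set pt i a k] =
  (normc (phi_hat N m0 (C i) (theta i) k%:Z (x + a%:~R - theta i k%:Z)) ^+ 2)%:E.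
Proof.
have h1 := path_set1_cvg P_path (Phi_seq_pt i a k).
have h2 := phi_hat_cvg N2 m0_lipschitz m0_ruelle (C_cycles.1 i) (theta_arg i)
  (k := k%:Z) (u := x + a%:~R - theta i k%:Z).
rewrite -(cvg_lim _ h1)//; apply: cvg_lim => //.
by apply: cvg_EFin h2; apply: nearW.
Qed.

Let i0 := Ordinal n_gt0.

(** All natural [k] are enumerated; those beyond the length of the cycle repeat earlier points, see
    [range_path_atoms]. Codes of no triple yield one of the same points. *)
Let f (j : nat) : borel_Omega N2 :=
  if unpickle j is Some (i, a, k) then pt i a k else pt i0 0 0.

(** The end of the word [s] is the start of a shadowing path of probability at least [r]. Extended
    back over [s], it becomes a point of the enumeration inside [cyl N2 s], whose mass is that of
    the cylinder times the mass of the tail. *)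
Lemma path_concentrated : P (~` range f) = 0%E.
Proof.
have [r r0 hr] := good_uniform N2 m0_lipschitz m0_zeros m0_ruelle n_gt0 C_cycles.
apply: (concentrated_on_atoms r0) => s.
have [i [k [u [zE hru]]]] := hr _ (normc_ez (tau_word x s)).
have cyc : is_cycle N (C i) by case: C_cycles => /(_ i)[].
pose L := line N (C i) (k + (size s)%:Z) (u * N%:R ^+ size s).
have LD l : L (l + (size s)%:Z) = line N (C i) k u l by exact: lineD.
have Ls : solenoid_set N L by exact: line_solenoid.
have Lw : L (size s)%:Z = ez (tau_word x s) by rewrite -[(size s)%:Z]add0r LD.
have Lj := solenoid_word N2 Ls Lw.
have L0 : L 0 = ez x by rewrite (Lj 0%N)// take0.
have [a [j [jC LE]]] := line_solenoid_pt cyc (theta_arg i) L0.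
have wL : Phi_seq x (pt i a j) = L by rewrite /pt -LE omegaK.
have ws : cyl N2 s (pt i a j).
  rewrite /cyl /=; apply: (@tau_word_inj _ _ N2 x); first by rewrite size_mkseq.
  by rewrite -Phi_seq_nat wL.
apply: (@le_trans _ _ (P [set pt i a j])); last first.
  apply: le_measure; rewrite ?inE.
  - exact: measurable_set1_path.
  - apply: measurableI; last exact: measurable_cyl.
    by apply: measurable_range; exact: measurable_set1_path.
  - by move=> _ ->; split => //; exists (pickle (i, a, j)) => //; rewrite /f pickleK.
have cv := path_set1_cvg P_path wL.
rewrite -(cvg_lim _ cv)//; apply: lime_ge; first by apply/cvg_ex; eexists; exact: cv.
(* For M at least the length of [s] the product splits there: the head is the mass of the cylinder
   and the tail is at least [r]. *)
exists (size s) => // M /= sM; rewrite (path_cyl P_path) -EFinM lee_fin.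
rewrite (big_cat_nat _ sM)//= mulrC.
have -> : \prod_(0 <= j < size s) weight N m0 (ez (tau_word x (take j.+1 s))) =
    \prod_(0 <= j < size s) weight N m0 (L j.+1%:Z).
  by apply: eq_big_nat => l /andP[_ ls]; rewrite Lj.
apply: ler_pM => //.
- by apply: prodr_ge0 => *; exact: weight_ge0.
- exact: ltW.
rewrite -{1}[size s]add0n big_addn.
under eq_bigr => l _.
  rewrite -addSn PoszD LD.
  over.
exact: hru.
Qed.

Lemma path_pure_point : atomic P.
Proof.
by apply: (atomic_range _ path_concentrated) => w; exact: measurable_set1_path.
Qed.

Lemma range_path_atoms : range f `<=`
  [set w | exists (i : 'I_n) (a : int) (k : nat), (k < size (C i))%N /\
    w = omega N2 x (solenoid_pt N (theta i) x a k%:Z)].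
Proof.
have H i a k : exists (i' : 'I_n) (a' : int) (k' : nat), (k' < size (C i'))%N /\
    pt i a k = pt i' a' k'.
  have cyc : is_cycle N (C i) by case: C_cycles => /(_ i)[].
  have := line_solenoid_pt (x := x) (k := k%:Z) (u := x + a%:~R - theta i k%:Z)
    cyc (theta_arg i).
  rewrite -(solenoid_ptE _ _ _ _ (theta_arg i)) => /(_ (solenoid_pt0 _ _ _ _ (theta_arg i))).
  by move=> [a' [k' [k'C e]]]; exists i, a', k'; rewrite /pt e.
by move=> _ [j _ <-]; rewrite /f; case: unpickle => [[[i a] k]|]; exact: H.
Qed.

Lemma path_negligible : P.-negligible
  (~` [set w : Omega N2 | exists (i : 'I_n) (a : int) (k : nat), (k < size (C i))%N /\
    w = omega N2 x (solenoid_pt N (theta i) x a k%:Z)]).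
Proof.
exists (~` range f); split; last exact/subsetC/range_path_atoms.
  by apply: measurableC; apply: measurable_range; exact: measurable_set1_path.
exact: path_concentrated.
Qed.

End PathMeasureIsAtomic.

(** * Points of the solenoid asymptotic to a cycle *)

Section Asymptotic.
Variables (R : realType) (N : nat) (N2 : (1 < N)%N).
Implicit Types (c : seq R[i]) (z : int -> R[i]) (k l : int).

Let N0 : (N%:R : R) != 0.
Proof. by rewrite pnatr_eq0 -lt0n ltnW. Qed.

Lemma normc_subX (a b : R[i]) n : normc a = 1 -> normc b = 1 ->
  normc (a ^+ n - b ^+ n) <= n%:R * normc (a - b).
Proof.
move=> a1 b1; elim: n => [|n IH]; first by rewrite subrr Normc.normc0 mul0r.
have -> : a ^+ n.+1 - b ^+ n.+1 = a * (a ^+ n - b ^+ n) + (a - b) * b ^+ n.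
  by rewrite !exprS; ring.
apply: (le_trans (le_normcD _ _)).
rewrite !Normc.normcM normcX a1 b1 expr1n mul1r mulr1 -natr1 mulrDl mul1r.
by rewrite lerD2r.
Qed.

(** Distance to the cycle at depth [r], rescaled by N^r. It is nondecreasing in [r], since the N-th
    power map expands distances on the circle at most N times, and it is bounded exactly on
    lines. *)
Definition gap c k z (r : nat) : R :=
  normc (z r%:Z - cycle_pt c (k - r%:Z)) * N%:R ^+ r.

Lemma gapS c k z r : is_cycle N c -> solenoid_set N z ->
  gap c k z r <= gap c k z r.+1.
Proof.
move=> cc zs; rewrite /gap exprS mulrA ler_wpM2r ?exprn_ge0//.
have -> : z r%:Z = z r.+1%:Z ^+ N by rewrite -(zs r%:Z).2 -PoszD addn1.
have -> : cycle_pt c (k - r%:Z) = cycle_pt c (k - r.+1%:Z) ^+ N.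
  by rewrite cycle_ptX// -addn1 PoszD opprD -!addrA addNr addr0.
have z1 : normc (z r.+1%:Z) = 1 by have [/normc_eq1] := zs r.+1%:Z.
by rewrite mulrC; apply: normc_subX => //; exact: normc_cycle_pt cc.
Qed.

Lemma gap_mono c k z a b : is_cycle N c -> solenoid_set N z -> (a <= b)%N ->
  gap c k z a <= gap c k z b.
Proof.
move=> cc zs; elim: b => [|b IH]; first by rewrite leqn0 => /eqP ->.
rewrite leq_eqVlt => /orP[/eqP ->//|]; rewrite ltnS => /IH h.
exact: le_trans h (gapS _ _ cc zs).
Qed.

Lemma solenoid_ext z y (r0 : nat) : solenoid_set N z -> solenoid_set N y ->
  (forall j : nat, z (r0 + j)%N%:Z = y (r0 + j)%N%:Z) -> z = y.
Proof.
move=> zs ys h.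
have H (j : nat) : z (r0%:Z - j%:Z) = y (r0%:Z - j%:Z).
  elim: j => [|j IH]; first by rewrite subr0; have := h 0%N; rewrite addn0.
  rewrite -(zs _).2 -(ys _).2 -addn1 PoszD opprD -!addrA addNr addr0.
  by rewrite IH.
apply/funext => l; have [rl|lr] := leP r0%:Z l.
  have -> : l = (r0 + `|l - r0%:Z|)%N%:Z by lia.
  exact: h.
have -> : l = r0%:Z - (`|r0%:Z - l|)%N%:Z by lia.
exact: H.
Qed.

(** The quotient of [z] by the cycle tends to 1, so deep coordinates have small arguments [t j]. As
    t j - N t (j + 1) is an integer of modulus less than 1, it vanishes, and the arguments are those
    of a line. *)
Lemma gap_bounded_line c k z (K : R) : is_cycle N c -> solenoid_set N z ->
  (forall r, gap c k z r <= K) -> exists u, z = line N c k u.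
Proof.
move=> cc zs hK; have NN : (0 : R) < N%:R by rewrite ltr0n ltnW.
(* With this bound [e] on the arguments, N e + e = 1/2 is less than 1. *)
have [|d d0 hd] := @ez_small R (1 / (2 * (N%:R + 1))).
  by rewrite divr_gt0// mulr_gt0// addr_gt0.
set e := 1 / _ in hd.
have eN : N%:R * e + e < 1.
  rewrite -[X in _ + X]mul1r -mulrDl /e mulrCA invfM mul1r mulrCA divff.
    by rewrite mulr1 invf_lt1// ltr1n.
  by rewrite gt_eqF// addr_gt0.
(* From depth [r0] on, a gap of at most K means a distance below [d]. *)
have [r0 hr0] : exists r0 : nat, K < d * N%:R ^+ r0.
  exists (Num.trunc `|K / d|).+1.
  rewrite mulrC -ltr_pdivrMr// (le_lt_trans (ler_norm _))//.
  apply: (lt_le_trans (truncnS_gt _)).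
  by rewrite -natrX ler_nat ltnW// ltn_expl.
pose w r := z r%:Z / cycle_pt c (k - r%:Z).
have cN0 l : cycle_pt c l != 0.
  by rewrite -normr_eq0; have /normc_eq1 -> := normc_cycle_pt l cc; rewrite oner_neq0.
have z1 l : normc (z l) = 1 by have [/normc_eq1] := zs l.
have zw r : z r%:Z = cycle_pt c (k - r%:Z) * w r by rewrite /w mulrCA divff// mulr1.
have w1 r : normc (w r) = 1.
  by rewrite Normc.normcM Normc.normcV z1 (normc_cycle_pt _ cc) divr1.
have wX r : w r.+1 ^+ N = w r.
  rewrite /w exprMn exprVn cycle_ptX//.
  have -> : z r.+1%:Z ^+ N = z r%:Z by rewrite -(zs r%:Z).2 -PoszD addn1.
  by congr (_ / cycle_pt _ _); rewrite -addn1 PoszD opprD addrA subrK.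
have /choice[t ht] j : exists t : R, ez t = w (r0 + j)%N /\ `|t| < e.
  have [|t tw te] := hd (w (r0 + j)%N) (w1 _); last by exists t.
  have <- : normc (z (r0 + j)%N%:Z - cycle_pt c (k - (r0 + j)%N%:Z)) =
      normc (w (r0 + j)%N - 1).
    rewrite zw -[X in _ - X]mulr1 -mulrBr Normc.normcM.
    by rewrite (normc_cycle_pt _ cc) mul1r.
  have Np : 0 < (N%:R : R) ^+ (r0 + j) by rewrite exprn_gt0.
  rewrite -(ltr_pM2r Np); apply: (le_lt_trans (hK _)); apply: (lt_le_trans hr0).
  by rewrite ler_wpM2l ?(ltW d0)// ler_weXn2l// ?ler1n ?(ltnW N2)// leq_addr.
have tS j : t j = t j.+1 * N%:R.
  have [ej tj] := ht j; have [ej1 tj1] := ht j.+1.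
  have : ez (t j.+1 * N%:R) = ez (t j) by rewrite mulr_natr ezMn ej1 addnS wX ej.
  move=> /ez_eq[a ha].
  have : `|a%:~R : R| < 1.
    have -> : (a%:~R : R) = t j.+1 * N%:R - t j by rewrite ha addrC addKr.
    apply: (le_lt_trans (ler_normB _ _)); apply: le_lt_trans eN.
    rewrite normrM [`|N%:R|]ger0_norm// [leRHS]addrC [leLHS]addrC.
    by rewrite lerD ?(ltW tj)// mulrC ler_wpM2l// ltW.
  rewrite -intr_norm -[1]/(1%:~R) ltr_int => a1.
  have a0 : a = 0 by lia.
  by rewrite ha a0 addr0.
exists (t 0%N * N%:R ^+ r0); apply: (@solenoid_ext _ _ r0 zs).
  exact: line_solenoid.
move=> j; rewrite zw /line -(ht j).1; congr (_ * ez _).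
have -> : t 0%N = t j * N%:R ^+ j.
  elim: j => [|j ->]; first by rewrite expr0 mulr1.
  by rewrite tS exprS mulrA.
by rewrite -exprnP -(mulrA (t j)) -exprD addnC mulfK// expf_neq0.
Qed.

End Asymptotic.

Lemma continuous_measurable_solenoid (R : realType) (N : nat)
    (f : solenoid R N -> R) : continuous f ->
  measurable_fun [set: borel_solenoid R N] (f : borel_solenoid R N -> R).
Proof.
move=> /continuousP cf; apply: (measurability _ (RGenOpens.measurableE R)).
move=> _ [_ [a [b ->] <-]]; rewrite setTI; apply: sub_sigma_algebra.
exact/cf/interval_open.
Qed.

Lemma solenoid_proj_continuous (R : realType) (N : nat) (l : int) :
  continuous (fun z : solenoid R N => set_val z l : R[i]).
Proof.
move=> z; apply: (@continuous_comp _ {ptws int -> R[i]} _ set_val (fun y => y l)).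
  exact: initial_continuous.
exact: (@proj_continuous int (fun=> R[i]) l).
Qed.

(** * The measure on the solenoid *)

Section Ramp.
Variable R : realType.

Definition ramp (t : R) : R := Num.min 1 (Num.max 0 (t - 1)).

Lemma ramp_ge0 t : 0 <= ramp t.
Proof. by rewrite /ramp le_min ler01 le_max lexx. Qed.

Lemma ramp_le1 t : ramp t <= 1.
Proof. by rewrite /ramp ge_min lexx. Qed.

Lemma ramp_eq0 t : t <= 1 -> ramp t = 0.
Proof.
move=> t1; have -> : ramp t = Num.min 1 0.
  by rewrite /ramp; congr Num.min; apply/max_idPl; rewrite subr_le0.
by apply/min_idPr.
Qed.

Lemma ramp_eq1 t : ramp t = 1 <-> 2 <= t.
Proof.
rewrite /ramp; split => [/min_idPl|t2].
  by rewrite le_max ler10 /= lerBrDr.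
by apply/min_idPl; rewrite le_max; apply/orP; right; rewrite lerBrDr.
Qed.

Lemma ramp_continuous : continuous ramp.
Proof.
move=> t; apply: (@continuous_min R R (cst 1) (fun t => Num.max 0 (t - 1))).
  exact: cst_continuous.
apply: (@continuous_max R R (cst 0) (fun t => t - 1)).
  exact: cst_continuous.
by apply: cvgB; [exact: cvg_id|exact: cvg_cst].
Qed.

End Ramp.

Section SolenoidMeasure.
Variables (R : realType) (N : nat) (N2 : (1 < N)%N) (m0 : R[i] -> R[i]).
Hypothesis m0_lipschitz : [lipschitz m0 z | z in circle R].
Hypothesis m0_zeros : finite_set (circle R `&` [set z | m0 z = 0]).
Hypothesis m0_ruelle : forall z, circle R z -> ruelle N m0 (fun=> 1) z = 1.
Variables (n : nat) (C : 'I_n -> seq R[i]).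
Hypotheses (n_gt0 : (0 < n)%N) (C_cycles : enumerates_m0_cycles N m0 C).
Variable theta : 'I_n -> int -> R.
Hypothesis theta_arg : forall i, is_argument (C i) (theta i).
Variable P : R -> probability (borel_Omega N2) R.
Hypothesis P_path : forall x : R, 0 <= x < 1 -> is_path_measure m0 x (P x).
Variable m : probability (borel_solenoid R N) R.
Hypothesis m_P : is_solenoid_measure P m.

Let cyc i : is_cycle N (C i).
Proof. by case: C_cycles => /(_ i)[]. Qed.

Let Q : finType := {i : 'I_n & 'I_(size (C i))}.

(* The points of a translated line approach their cycle at the rate N^-r, so the
   distance of z_r to the cycle is measured at that scale. *)
Definition phase_gap (q : Q) (r : nat) (z : R[i]) : R :=
  normc (z - cycle_pt (C (tag q)) ((tagged q : nat)%:Z - r%:Z)) * N%:R ^+ r.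

(** A continuous test function that is 0 when some phase of some cycle is within rescaled distance M
    + 1, and 1 exactly when all are at distance at least 2 (M + 1). *)
Definition cutoff (M r : nat) (z : R[i]) : R :=
  \prod_(q : Q) ramp (phase_gap q r z / M.+1%:R).

Lemma cutoff_ge0 M r z : 0 <= cutoff M r z.
Proof. by apply: prodr_ge0 => q _; exact: ramp_ge0. Qed.

Lemma cutoff_le1 M r z : cutoff M r z <= 1.
Proof. by apply: prodr_ile1 => q _; rewrite ramp_ge0 ramp_le1. Qed.

Lemma cutoff_eq0 M r z q : phase_gap q r z <= M.+1%:R -> cutoff M r z = 0.
Proof.
move=> h; rewrite /cutoff (bigD1 q)//= ramp_eq0 ?mul0r//.
by rewrite ler_pdivrMr ?ltr0n// mul1r.
Qed.

Lemma cutoff_eq1 M r z :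
  cutoff M r z = 1 <-> forall q, 2 * M.+1%:R <= phase_gap q r z.
Proof.
split => [h q|h]; last first.
  by rewrite /cutoff big1// => q _; apply/ramp_eq1; rewrite ler_pdivlMr ?ltr0n.
rewrite -ler_pdivlMr ?ltr0n//; apply/ramp_eq1/eqP; rewrite eq_le ramp_le1 /=.
rewrite -[leLHS]h /cutoff (bigD1 q)//= ler_piMr ?ramp_ge0//.
by apply: prodr_ile1 => q' _; rewrite ramp_ge0 ramp_le1.
Qed.

Lemma cutoff_continuous M r : continuous (cutoff M r : R[i] -> R).
Proof.
apply: (@continuous_big R Q *%R 1 predT (@mul_continuous R)) => q _ z.
apply: (@continuous_comp _ _ _ (fun z => phase_gap q r z / M.+1%:R) (@ramp R)); last exact: ramp_continuous.
have h : phase_gap q r y @[y --> z] --> phase_gap q r z.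
  rewrite /phase_gap; set c := cycle_pt _ _.
  have h2 : (normc (y - c) : R) @[y --> z] --> normc (z - c).
    exact: normc_sub_continuous.
  exact: cvgMr_tmp h2.
exact: cvgMr_tmp h.
Qed.

Let ft M r (z : solenoid R N) : R := cutoff M r (set_val z r%:Z).

Let ft_continuous M r : continuous (ft M r).
Proof.
move=> z; apply: (@continuous_comp _ _ _ (fun z : solenoid R N => set_val z r%:Z : R[i])
  (cutoff M r)); first exact: solenoid_proj_continuous.
exact: cutoff_continuous.
Qed.

(** The integral of the cutoff against [P x], see [path_cutoffE], written as a finite sum so that
    its continuity in [x] is visible. *)
Definition path_cutoff M r x : R :=
  \sum_(v : r.-tuple 'I_N) cutoff M r (ez (tau_word x v)) *
    \prod_(j < r) W N m0 (tau_word x (take j.+1 v)).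

Lemma tau_word_continuous (s : seq 'I_N) : continuous (fun x : R => tau_word x s).
Proof.
elim/last_ind: s => [|s k IH] x; first exact: cvg_id.
under eq_fun do rewrite /tau_word foldl_rcons.
apply: cvgMr_tmp.
by apply: cvgD; [exact: IH|exact: cvg_cst].
Qed.

Lemma ez_continuous : continuous (@ez R).
Proof.
have pi0 := pi_gt0 R.
move=> x A [e /= e0 eA]; have [e1 eE] := posC e0.
have e2 : 0 < complex.Re e / (2 * pi) by rewrite divr_gt0// mulr_gt0.
exists (complex.Re e / (2 * pi)) => //= y; rewrite /ball_ /= => xy; apply: eA.
rewrite /ball_ /= normE eE ltcR (le_lt_trans (normc_ez_sub _ _))//.
by rewrite mulrC -ltr_pdivlMr// mulr_gt0.
Qed.

Lemma path_cutoff_continuous M r : continuous (path_cutoff M r).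
Proof.
apply: (@continuous_big R _ +%R 0 predT (@add_continuous R)) => v _ x.
apply: cvgM.
  apply: (@continuous_comp _ _ _ (fun x => ez (tau_word x v)) (cutoff M r)); last first.
    exact: cutoff_continuous.
  apply: (@continuous_comp _ _ _ (fun x => tau_word x v)); last exact: ez_continuous.
  exact: tau_word_continuous.
apply: (@continuous_big R _ *%R 1 predT (@mul_continuous R)) => j _ {}x.
apply: (@continuous_comp _ _ _ (fun x => tau_word x (take j.+1 v)) (W N m0)).
  exact: tau_word_continuous.
exact: (weight_ez_continuous N2 m0_lipschitz m0_ruelle).
Qed.

Lemma path_cutoffE M r x : 0 <= x < 1 ->
  (\int[P x]_w (ft M r (Phi x (w : Omega N2)))%:E = (path_cutoff M r x)%:E)%E.
Proof.
move=> x01.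
rewrite -(P_path x01 (fun v : r.-tuple 'I_N => cutoff M r (ez (tau_word x v)))).
apply: eq_integral => w _; congr EFin; rewrite /ft.
by rewrite tupleE.
Qed.


Let far x M r : set (borel_Omega N2) :=
  [set w | forall q, M.+1%:R < phase_gap q r (ez (tau_word x (mkseq (w : Omega N2) r)))].

Let measurable_far x M r : measurable (far x M r).
Proof.
have := @measurable_tuple_pred _ N2 r
  (fun v => [forall q, M.+1%:R < phase_gap q r (ez (tau_word x v))]).
congr measurable; apply/seteqP; split => w /=; rewrite tupleE.
  by move=> /forallP.
by move=> h; apply/forallP.
Qed.

Let escape x M := \bigcup_r far x M r.

Let measurable_escape x M : measurable (escape x M).
Proof. by apply: bigcup_measurable => r _; exact: measurable_far. Qed.

Lemma path_cutoff_ge0 M r x : 0 <= x < 1 -> 0 <= path_cutoff M r x.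
Proof.
move=> x01; rewrite -lee_fin -path_cutoffE//; apply: integral_ge0 => w _.
by rewrite lee_fin cutoff_ge0.
Qed.

Let path_cutoff_le M r x : 0 <= x < 1 ->
  ((path_cutoff M r x)%:E <= P x (escape x M))%E.
Proof.
move=> x01; rewrite -path_cutoffE//.
have mf : measurable_fun [set: borel_Omega N2]
    (fun w : borel_Omega N2 => (ft M r (Phi x (w : Omega N2)))%:E).
  apply/measurable_EFinP; apply: (measurability _ (RGenOpens.measurableE R)).
  move=> _ [_ [a [b ->] <-]]; rewrite setTI.
  have := @measurable_tuple_pred _ N2 r
    (fun v => cutoff M r (ez (tau_word x v)) \in `]a, b[).
  by congr measurable; apply/seteqP; split => w /=; rewrite /ft tupleE.
apply: (@le_trans _ _ (\int[P x]_w (\1_(far x M r) w)%:E)%E).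
  apply: ge0_le_integral => //.
  - by move=> w _; rewrite lee_fin cutoff_ge0.
  - by apply/measurable_EFinP; apply: measurable_indic; exact: measurable_far.
  - move=> w _; rewrite lee_fin indicE; case: (boolP (w \in far x M r)) => [_|].
      exact: cutoff_le1.
    rewrite notin_setE => /existsNP[q /negP]; rewrite -leNgt => h.
    by rewrite /ft (@cutoff_eq0 _ _ _ q).
have mfar := measurable_far x M r.
rewrite (integral_indic _ measurableT)// setIT; apply: le_measure; rewrite ?inE; last exact: bigcup_sup.
  exact: mfar.
exact: measurable_escape.
Qed.

(** The sets [escape x M] decrease with [M], and their intersection misses every point
    omega(x,i,a,k): on a line of parameter [u] all gaps are at most 2 pi |u|. That intersection is
    therefore null. *)
Let escape_cvg x : 0 <= x < 1 -> (P x) (escape x M) @[M --> \oo] --> 0%E.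
Proof.
move=> x01; pose E := \bigcap_M escape x M.
have mE : measurable E by apply: bigcap_measurable => // M _; exact: measurable_escape.
have <- : P x E = 0%E.
  have [B [mB B0 hB]] := path_negligible m0_lipschitz m0_zeros m0_ruelle n_gt0
    C_cycles theta_arg (P_path x01).
  apply/eqP; rewrite -measure_le0 -B0; apply: le_measure; rewrite ?inE//.
  move=> w Ew; apply: hB => -[i [a [k [kC wE]]]].
  pose u := x + a%:~R - theta i k%:Z.
  have [r _ hr] := Ew (Num.trunc (2 * pi * `|u|)) I.
  have := hr (Tagged (fun i => 'I_(size (C i))) (Ordinal kC)).
  rewrite -Phi_seq_nat wE (Phi_seq_pt N2 C_cycles theta_arg) /phase_gap /= -/u.
  apply/negP; rewrite -leNgt.
  have Np : 0 < (N%:R : R) ^+ r by rewrite exprn_gt0// ltr0n ltnW.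
  rewrite -ler_pdivlMr//; apply: (le_trans (line_dist _ _ _ (cyc i))).
  by rewrite -exprnP ler_wpM2r ?invr_ge0 ?(ltW Np)// ltW// truncnS_gt.
apply: nonincreasing_cvg_mu.
- by rewrite (le_lt_trans (probability_le1 _ _)) ?ltry//; exact: measurable_escape.
- by move=> M; exact: measurable_escape.
- exact: mE.
- move=> a b ab; apply/subsetPset => w [r _ h]; exists r => // q.
  by apply: le_lt_trans (h q); rewrite ler_nat.
Qed.

(** A countable supremum of continuous functions, hence measurable in [x]. It lies between 0 and
    [P x (escape x M)], so it tends to 0 with bound 1, and it controls all depths [r] at once. *)
Let sup_cutoff M x : \bar R := esups (fun r => (path_cutoff M r x)%:E) 0.

Let sup_cutoff_ge M r x : ((path_cutoff M r x)%:E <= sup_cutoff M x)%E.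
Proof. by apply: ereal_sup_ubound; exists r. Qed.

Let sup_cutoff_le M x : 0 <= x < 1 -> (sup_cutoff M x <= P x (escape x M))%E.
Proof.
by move=> x01; apply: ge_ereal_sup => _ [r _ <-]; exact: path_cutoff_le.
Qed.

Let sup_cutoff_ge0 M x : 0 <= x < 1 -> (0 <= sup_cutoff M x)%E.
Proof.
move=> x01; apply: le_trans (sup_cutoff_ge M 0 x).
by rewrite lee_fin path_cutoff_ge0.
Qed.

Let I01 : set R := `[0, 1[%classic.

Let I01P x : I01 x -> 0 <= x < 1.
Proof. by rewrite /I01 /= in_itv. Qed.

Let measurable_path_cutoff M r (D : set R) :
  measurable_fun D (fun x => (path_cutoff M r x)%:E).
Proof.
apply/measurable_EFinP; apply: measurable_funTS.
by apply: continuous_measurable_fun; exact: path_cutoff_continuous.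
Qed.

Let measurable_sup_cutoff M (D : set R) : measurable_fun D (sup_cutoff M).
Proof.
apply: (@measurable_fun_esups _ _ R D (fun r x => (path_cutoff M r x)%:E)) => r.
exact: measurable_path_cutoff.
Qed.

Let int_sup_cutoff_cvg :
  (\int[lebesgue_measure]_(x in I01) sup_cutoff M x @[M --> \oo] --> 0)%E.
Proof.
have mI : measurable I01 by exact: measurable_itv.
have [] := @dominated_convergence _ _ _ (@lebesgue_measure R) I01 mI
  sup_cutoff (cst 0%E) (cst 1%E).
- by move=> M; exact: measurable_sup_cutoff.
- exact: measurable_cst.
- apply: aeW => x /I01P x01.
  apply: (@squeeze_cvge _ _ _ _ (fun=> 0%E) _ (fun M => P x (escape x M))).
  + by apply: nearW => M; rewrite sup_cutoff_ge0// sup_cutoff_le.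
  + exact: cvg_cst.
  + exact: escape_cvg.
- apply/integrableP; split; first exact: measurable_cst.
  rewrite (eq_integral (cst 1%E)) => [|y _]; last by rewrite /= normr1.
  rewrite integral_cst// mul1e; have l01 : (lebesgue_measure I01 < +oo)%E.
    by rewrite /I01 lebesgue_measure_itv /= lte_fin ltr01 sube0 ltry.
  exact: l01.
- apply: aeW => x M /I01P x01; rewrite gee0_abs ?sup_cutoff_ge0//.
  apply: (le_trans (sup_cutoff_le M x01)).
  by apply: probability_le1; exact: measurable_escape.
by move=> _ _; rewrite integral0.
Qed.

Let G M r : set (borel_solenoid R N) :=
  [set z | cutoff M r (set_val (z : solenoid R N) r%:Z) = 1].

Let measurable_G M r : measurable (G M r).
Proof.
have /(_ measurableT [set 1] (measurable_set1 1)) := continuous_measurable_solenoid (@ft_continuous M r).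
by rewrite setTI.
Qed.

(** The indicator of [G M r] is at most the cutoff, whose [m]-integral is computed through [m_P];
    the resulting bound does not depend on [r]. *)
Let G_le M r : (m (G M r) <= \int[lebesgue_measure]_(x in I01) sup_cutoff M x)%E.
Proof.
apply: (@le_trans _ _ (\int[m]_z (ft M r (z : solenoid R N))%:E)%E).
  rewrite -[G M r]setIT -integral_indic//.
  apply: ge0_le_integral => //.
  - by apply/measurable_EFinP; exact: measurable_indic.
  - by apply/measurable_EFinP; exact: continuous_measurable_solenoid.
  - move=> z _; rewrite lee_fin indicE; case: (boolP (z \in G M r)) => [|_].
      by rewrite inE /G /= /ft => ->.
    exact: cutoff_ge0.
rewrite m_P; last exact: ft_continuous.
apply: (@le_trans _ _ (\int[lebesgue_measure]_(x in I01) (path_cutoff M r x)%:E)%E).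
  rewrite le_eqVlt; apply/orP; left; apply/eqP; apply: eq_integral => x.
  by rewrite inE => /I01P x01; rewrite path_cutoffE.
apply: ge0_le_integral.
- exact: measurable_itv.
- by move=> x /I01P x01; rewrite lee_fin path_cutoff_ge0.
- exact: measurable_path_cutoff.
- exact: measurable_sup_cutoff.
- by move=> x _; exact: sup_cutoff_ge.
Qed.

Let G_nd M : nondecreasing_seq (G M).
Proof.
move=> a b ab; apply/subsetPset => z /cutoff_eq1 h; apply/cutoff_eq1 => q.
apply: (le_trans (h q)).
exact: (gap_mono _ (cyc _) (set_valP z) ab).
Qed.

(** The points that, at every scale, are eventually far from all phases of all cycles. *)
Let null_set := \bigcap_M \bigcup_r G M r.

Let null_set0 : m null_set = 0%E.
Proof.
have mG M : measurable (\bigcup_r G M r) by exact: bigcup_measurable.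
have mn : measurable null_set by exact: bigcap_measurable.
have h M : (m null_set <= \int[lebesgue_measure]_(x in I01) sup_cutoff M x)%E.
  apply: (@le_trans _ _ (m (\bigcup_r G M r))).
    by apply: le_measure; rewrite ?inE//; exact: bigcap_inf.
  have cv : m \o G M @ \oo --> m (\bigcup_r G M r).
    exact: nondecreasing_cvg_mu.
  rewrite -(cvg_lim _ cv)//; apply: lime_le; first by apply/cvg_ex; eexists; exact: cv.
  by apply: nearW => r; exact: G_le.
apply/eqP; rewrite -measure_le0 -(cvg_lim _ int_sup_cutoff_cvg)//.
apply: lime_ge; first by apply/cvg_ex; eexists; exact: int_sup_cutoff_cvg.
exact: nearW.
Qed.

Lemma translated_lineP (c : seq R[i]) (k : nat) (z : solenoid R N) :
  translated_line c k z <-> exists u, set_val z = line N c (- k%:Z) u.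
Proof.
have H u : iter k (@shift_inv R) (cycle_solenoid c) \* i_hat N u = line N c (- k%:Z) u.
  have it j l : iter j (@shift_inv R) (cycle_solenoid c) l = cycle_pt c (- (l + j%:Z)).
    elim: j l => [|j IH] l; first by rewrite addr0.
    by rewrite iterS /shift_inv IH; congr cycle_pt; rewrite -addn1 PoszD; ring.
  apply/funext => l; rewrite /= it /line /i_hat; congr (cycle_pt _ _ * ez _).
    by ring.
  by rewrite mulrC invr_expz.
by split => -[u h]; exists u; rewrite h H.
Qed.

Lemma solenoid_negligible : m.-negligible
  (~` [set z : solenoid R N | exists (i : 'I_n) (k : nat),
        (k < size (C i))%N /\ translated_line (C i) k z]).
Proof.
exists null_set; split; first by apply: bigcap_measurable => // M _; exact: bigcup_measurable.
  exact: null_set0.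
move=> z nz M _; apply: contrapT => /forallPNP h; apply: nz.
have zs : solenoid_set N (set_val z) := set_valP z.
(* If each phase were far at some depth of its own, monotonicity of the gaps would make all of them
   far at the largest of these depths. *)
have [q hq] : exists q : Q, forall r, phase_gap q r (set_val z r%:Z) < 2 * M.+1%:R.
  apply: contrapT => /forallNP nq.
  have /choice[r hr] (q : Q) : exists r, 2 * M.+1%:R <= phase_gap q r (set_val z r%:Z).
    by have /existsNP[r /negP] := nq q; rewrite -leNgt; exists r.
  apply: (h (\max_q r q)%N I); apply/cutoff_eq1 => q.
  apply: (le_trans (hr q)); apply: (gap_mono _ (cyc _) zs).
  exact: leq_bigmax.
have [u zu] := gap_bounded_line N2 (cyc (tag q)) zs (fun r => ltW (hq r)).
have [c0 _ _ _] := cyc (tag q).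
have p0 : (size (C (tag q)))%:Z != 0 by rewrite eqz_nat -lt0n.
(* The translated line of index [k] has phase -k, so the phase is negated modulo the length. *)
pose k := `|(- (tagged q : nat)%:Z %% (size (C (tag q)))%:Z)%Z|%N.
exists (tag q), k; split; first exact: cycle_index.
apply/translated_lineP; exists u; rewrite zu; apply/funext => l; apply: line_mod.
by rewrite /k gez0_abs ?modz_ge0// modzNm opprK.
Qed.

End SolenoidMeasure.

Unset Implicit Arguments.

Theorem proposition5p3 (R : realType) (N : nat) (N2 : (1 < N)%N)
    (m0 : R[i] -> R[i])
    (m0_lipschitz : [lipschitz m0 z | z in circle R])
    (m0_zeros : finite_set (circle R `&` [set z | m0 z = 0]))
    (m0_ruelle : forall z, circle R z -> ruelle N m0 (fun=> 1) z = 1)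
    (n : nat) (n_gt0 : (0 < n)%N)
    (C : 'I_n -> seq R[i]) (C_cycles : enumerates_m0_cycles N m0 C)
    (theta : 'I_n -> int -> R)
    (theta_arg : forall i, is_argument (C i) (theta i))
    (P : R -> probability (borel_Omega N2) R)
    (P_path : forall x : R, 0 <= x < 1 -> is_path_measure m0 x (P x))
    (m : probability (borel_solenoid R N) R)
    (m_P : is_solenoid_measure P m) :
  (forall x : R, 0 <= x < 1 ->
    [/\ atomic (P x),
        (P x).-negligible (~` [set w : Omega N2 | exists (i : 'I_n) (a : int) (k : nat),
          (k < size (C i))%N /\
          w = omega N2 x (solenoid_pt N (theta i) x a k%:Z)])
      & forall (i : 'I_n) (a : int) (k : nat), (k < size (C i))%N ->
          P x [set omega N2 x (solenoid_pt N (theta i) x a k%:Z)] =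
          ((Normc.normc (phi_hat N m0 (C i) (theta i) k%:Z
                           (x + a%:~R - theta i k%:Z))) ^+ 2)%:E]) /\
  m.-negligible
    (~` [set z : solenoid R N | exists (i : 'I_n) (k : nat),
          (k < size (C i))%N /\ translated_line (C i) k z]).
Proof.
split; last exact: (solenoid_negligible m0_lipschitz m0_zeros m0_ruelle n_gt0
  C_cycles theta_arg P_path m_P).
move=> x x01; split.
- exact: (path_pure_point m0_lipschitz m0_zeros m0_ruelle n_gt0 C_cycles theta_arg
    (P_path x x01)).
- exact: (path_negligible m0_lipschitz m0_zeros m0_ruelle n_gt0 C_cycles theta_arg
    (P_path x x01)).
- move=> i a k _.
  exact: (path_atom m0_lipschitz m0_ruelle C_cycles theta_arg (P_path x x01)).
Qed.
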